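(* There exists a freely infinitely divisible (FID) probability measure $\mu$ on $\mathbb{R}$, whose free L\'evy measure does not have bounded support, such that $\mu^{\boxplus s}$ is not unimodal for any $s>0$. Moreover, $\mu$ can be taken to have finite moments of all orders.
   Context: Unimodality: a Borel measure $\rho$ on $\mathbb{R}$ is unimodal if for some $c\in\mathbb{R}$, $\rho(dt)=\rho(\{c\})\delta_c(dt)+f(t)\,dt$, where $f\colon\mathbb{R}\to[0,\infty)$ is non-decreasing on $(-\infty,c)$ and non-increasing on $(c,\infty)$. Free convolution: for a probability measure $\mu$ on $\mathbb{R}$ let $G_\mu(z)=\int_{\mathbb{R}}\frac{1}{z-x}\,\mu(dx)$ and $F_\mu(z)=1/G_\mu(z)$ for $z\in\mathbb{C}^+$. The right compositional inverse $F_\mu^{-1}$ exists on a truncated cone $\{z\in\mathbb{C}^+ : \operatorname{Im}(z)>M,\ |\operatorname{Re}(z)|<\lambda\operatorname{Im}(z)\}$. The free cumulant transform is $\mathcal{C}_\mu(z)=zF_\mu^{-1}(1/z)-1$ (for $1/z$ in the cone). The free convolution $\boxplus$ is characterized by $\mathcal{C}_{\mu\boxplus\rho}=\mathcal{C}_\mu+\mathcal{C}_\rho$ on the common domain. FID measures: $\mu$ is freely infinitely divisible (FID) if for every $n\in\mathbb{N}$ there is a probability measure $\mu_n$ with $\mu_n^{\boxplus n}=\mu$. Equivalently, $\mathcal{C}_\mu$ extends to $\mathbb{C}^-$ with the free L\'evy--Khintchine representation $$\mathcal{C}_\mu(z)=\eta_\mu z+a_\mu z^2+\int_{\mathbb{R}}\Big(\frac{1}{1-tz}-1-tz1_{[-1,1]}(t)\Big)\nu_\mu(dt),\qquad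 z\in\mathbb{C}^-,$$ where $\eta_\mu\in\mathbb{R}$, $a_\mu\ge0$ and $\nu_\mu$ is a nonnegative measure on $\mathbb{R}$ with $\nu_\mu(\{0\})=0$ and $\int_{\mathbb{R}}\min\{1,t^2\}\,\nu_\mu(dt)<\infty$. The triplet $(\eta_\mu,a_\mu,\nu_\mu)$ is unique and called the free characteristic triplet; $\nu_\mu$ is the free L\'evy measure. For $s\ge0$, $\mu^{\boxplus s}$ denotes the FID measure with free characteristic triplet $(s\eta_\mu,sa_\mu,s\nu_\mu)$. *)

(* Defs.v *)
From HB Require Import structures.
From mathcomp Require Import all_boot all_order all_algebra.
From mathcomp Require Import complex.
From mathcomp Require Import all_classical all_reals all_analysis.

Set Implicit Arguments.
Unset Strict Implicit.
Unset Printing Implicit Defensive.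

Import Order.TTheory GRing.Theory Num.Theory.
Import numFieldNormedType.Exports.

Local Open Scope classical_set_scope.
Local Open Scope ring_scope.
Local Open Scope complex_scope.

Definition unimodal (R : realType)
    (rho : {measure set (measurableTypeR R) -> \bar R}) : Prop :=
  exists (c : R) (f : R -> R),
    [/\ forall t, 0 <= f t,
        forall t u, t <= u -> u < c -> f t <= f u,
        forall t u, c < t -> t <= u -> f u <= f t
      & forall A : set (measurableTypeR R), measurable A ->
          (rho A = rho [set c] * \d_c A
                   + \int[lebesgue_measure]_(t in A) (f t)%:E)%E].

(* The topological support: the points all of whose open neighbourhoods have
   positive mass. *)
Definition msupport (R : realType)
    (nu : {measure set (measurableTypeR R) -> \bar R}) : set R :=
  [set x | forall U : set R, open U -> U x -> (0 < nu U)%E].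

(* Meaningful when the real and imaginary parts of [f] are integrable, which
   is the case for the two integrands below: they are bounded by a constant,
   resp. by a constant times min(1, t^2), as soon as z is not real. *)
Definition Cintegral (R : realType)
    (m : {measure set (measurableTypeR R) -> \bar R}) (f : R -> R[i]) : R[i] :=
  Rintegral m setT (fun x => complex.Re (f x))
  +i* Rintegral m setT (fun x => complex.Im (f x)).

Definition cauchy_transform (R : realType)
    (mu : probability (measurableTypeR R) R) (z : R[i]) : R[i] :=
  Cintegral mu (fun x => 1 / (z - x%:C)).

Definition F_transform (R : realType)
    (mu : probability (measurableTypeR R) R) (z : R[i]) : R[i] :=
  1 / cauchy_transform mu z.

(* [l] is the aperture lambda and [M] the truncation height. *)
Definition truncated_cone (R : realType) (l M : R) : set R[i] :=
  [set z | M < complex.Im z /\ `|complex.Re z| < l * complex.Im z].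

(* [g] is the right compositional inverse of F_mu on the cone (l, M), with
   values in the upper half-plane. A right inverse alone need not be unique:
   F_mu(z) = z - 1/z (mu a symmetric Bernoulli law) has a second holomorphic
   right inverse, equivalent to -1/z at infinity. The last clause selects the
   branch that inverts F_mu near infinity in a cone; by the identity theorem,
   [g] is then determined on the whole cone (l, M). *)
Definition F_inverse (R : realType) (mu : probability (measurableTypeR R) R)
    (l M : R) (g : R[i] -> R[i]) : Prop :=
  [/\ forall z, truncated_cone l M z -> 0 < complex.Im (g z),
      forall z, truncated_cone l M z -> F_transform mu (g z) = z,
      forall z, truncated_cone l M z -> derivable (g : R[i]^o -> R[i]^o) z 1
    & exists l' M' : R, [/\ 0 < l', 0 < M' &
        forall w, truncated_cone l' M' w ->
          truncated_cone l M (F_transform mu w) ->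
          g (F_transform mu w) = w]].

(* [C] is the free cumulant transform of mu, at the points z such that 1/z
   lies in the cone (l, M); its values elsewhere are irrelevant. *)
Definition free_cumulant_transform (R : realType)
    (mu : probability (measurableTypeR R) R) (l M : R) (C : R[i] -> R[i]) :
    Prop :=
  exists2 g : R[i] -> R[i], F_inverse mu l M g &
    forall z, truncated_cone l M (1 / z) -> C z = z * g (1 / z) - 1.

(* [sigma] is the free convolution of mu and rho. Free cumulant transforms
   are holomorphic, so it does not matter on which cone the three of them are
   compared. *)
Definition free_convolution (R : realType)
    (mu rho sigma : probability (measurableTypeR R) R) : Prop :=
  exists (l M : R) (Cmu Crho Csigma : R[i] -> R[i]),
    [/\ 0 < l /\ 0 < M,
        free_cumulant_transform mu l M Cmu,
        free_cumulant_transform rho l M Crho,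
        free_cumulant_transform sigma l M Csigma
      & forall z, truncated_cone l M (1 / z) -> Csigma z = Cmu z + Crho z].

(* [sigma] is the n-fold free convolution of mu; the Dirac mass at 0 is the
   neutral element of free convolution. *)
Fixpoint nfold_free_convolution (R : realType)
    (mu : probability (measurableTypeR R) R) (n : nat)
    (sigma : probability (measurableTypeR R) R) : Prop :=
  if n is m.+1 then
    exists2 tau : probability (measurableTypeR R) R,
      nfold_free_convolution mu m tau & free_convolution tau mu sigma
  else
    forall A : set (measurableTypeR R), measurable A ->
      sigma A = \d_(0 : R) A.

Definition freely_infinitely_divisible (R : realType)
    (mu : probability (measurableTypeR R) R) : Prop :=
  forall n : nat, (0 < n)%N ->
    exists mu_n : probability (measurableTypeR R) R,
      nfold_free_convolution mu_n n mu.

Definition levy_khintchine (R : realType) (eta a : R)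
    (nu : {measure set (measurableTypeR R) -> \bar R}) (z : R[i]) : R[i] :=
  eta%:C * z + a%:C * z ^+ 2 +
  Cintegral nu (fun t =>
    1 / (1 - t%:C * z) - 1 - t%:C * z * (\1_(`[-1, 1] : set R) t)%:C).

(* (eta, a, nu) is the free characteristic triplet of mu. The condition
   1/z in a truncated cone implies Im z < 0, and [levy_khintchine eta a nu] is
   holomorphic on the lower half-plane, so that it is there the analytic
   extension of the free cumulant transform. *)
Definition free_characteristic_triplet (R : realType)
    (mu : probability (measurableTypeR R) R) (eta a : R)
    (nu : {measure set (measurableTypeR R) -> \bar R}) : Prop :=
  [/\ 0 <= a,
      nu [set 0%R] = 0%E,
      (\int[nu]_t (Num.min 1 (t ^+ 2))%:E < +oo)%E
    & exists (l M : R) (C : R[i] -> R[i]),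
        [/\ 0 < l, 0 < M, free_cumulant_transform mu l M C &
            forall z, truncated_cone l M (1 / z) ->
              C z = levy_khintchine eta a nu z]].

Definition free_levy_measure (R : realType)
    (mu : probability (measurableTypeR R) R)
    (nu : {measure set (measurableTypeR R) -> \bar R}) : Prop :=
  exists eta a : R, free_characteristic_triplet mu eta a nu.

(* [sigma] is the free convolution power of mu of real exponent s >= 0. *)
Definition free_power (R : realType)
    (mu : probability (measurableTypeR R) R) (s : {nonneg R})
    (sigma : probability (measurableTypeR R) R) : Prop :=
  exists (eta a : R) (nu : {measure set (measurableTypeR R) -> \bar R}),
    free_characteristic_triplet mu eta a nu /\
    free_characteristic_triplet sigma (s%:num * eta) (s%:num * a)
      (mscale s nu).

(* Main.v *)
Require Import Defs.
From HB Require Import structures.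
From mathcomp Require Import all_boot all_order all_algebra.
From mathcomp Require Import complex spectral sesquilinear.
From mathcomp Require Import all_classical all_reals all_analysis.
From mathcomp Require Import measurable_realfun.
From mathcomp Require Import ring lra.

Import Order.TTheory GRing.Theory Num.Theory.
Import numFieldNormedType.Exports.
Import Normc.

Set Implicit Arguments.
Unset Strict Implicit.
Unset Printing Implicit Defensive.

Local Open Scope classical_set_scope.
Local Open Scope ring_scope.
Local Open Scope complex_scope.

Local Notation Re := complex.Re.
Local Notation Im := complex.Im.

(** The free Levy measure of mu is nu = sum_k w_k / x_k^2 delta_{x_k} with
    x_k = 2^(k+1) and w_k = 1/k!. With a suitable drift, the free cumulant
    transform of the power of exponent s is s z phi(1/z), where
    phi(w) = sum_k w_k / (w - x_k). Thus mu^(s) is the probability measure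
    whose reciprocal Cauchy transform F solves F(z) + s phi(F(z)) = z when
    Im z is large; this is the predicate free_law, and addition of the
    exponents s is free convolution (law_convolution), whence free infinite
    divisibility.

    Existence of mu^(s). Solve the equation by the iteration
    F_0(z) = z, F_(n+1)(z) = z - s sum_(k<n) w_k / (F_n(z) - x_k). Each F_n is
    a rational function of the form z - sum_j a_j / (z - p_j) with a_j > 0 and
    p_j real, and the resolvent 1/(F_n - t), t real, is again a sum
    sum_j m_j / (z - q_j) with m_j > 0 of sum 1: it is a matrix entry of the
    resolvent of a Hermitian arrowhead matrix (arrowhead_spectral). In
    particular 1/F_n is the Cauchy transform of a probability measure with
    finitely many atoms. Where Im z is large the iteration contracts
    (iterF_cvg), and a weak limit of these measures, extracted along an
    ultrafilter (helly_selection), is mu^(s) (law_exists).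

    Gaps. The same iteration can be followed on the real line: at a real t
    whose distance to every x_k is at least S + 2, where S = s exp 1 bounds
    s sum_k w_k, all F_n(t) stay within distance 1 of t (iterF_gap). So none
    of the approximating measures charges such a t with |t| > 1, and mu^(s)
    charges neither ]-oo, -(S + 2)[ nor ]x_k + S + 2, x_(k+1) - S - 2[ for
    large k (law_with_gaps).

    Non-unimodality. If mu^(s) were unimodal with mode c, its density would
    vanish on a gap beyond c, hence everywhere beyond that gap: mu^(s) would
    be carried by an interval [-B, B], and its moment of order 2k would be at
    most B^(2k). However, the equation of F yields an asymptotic expansion of
    z G(z) in powers of 1/z along the imaginary axis (zG_expansion). The
    coefficients are obtained from the moments of sum_k w_k delta_{x_k} by
    sums and products only, hence they are nonnegative, and the coefficient of
    order 2k + 2 is at least s w_i x_i^(2k) for every i. These coefficients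
    are the moments of mu^(s), which are finite (even_moments), and
    s w_i x_i^(2k) exceeds B^(2k+2) for large k as soon as x_i >= 2 B. *)

(** * Modulus, real and imaginary parts of complex numbers *)

Section complex_modulus.
Context {R : realType}.
Implicit Types (z w : R[i]) (x : R).

Lemma normcD_le z w : normc (z + w) <= normc z + normc w.
Proof. exact: le_normcD. Qed.

Lemma normc_opp z : normc (- z) = normc z.
Proof. exact: normcN. Qed.

Lemma normc_ge0 z : 0 <= normc z.
Proof. by case: z => a b; exact: sqrtr_ge0. Qed.

Lemma normcB z w : normc (z - w) = normc (w - z).
Proof. by rewrite -normc_opp opprB. Qed.

Lemma normc_sum (I : Type) (r : seq I) (F : I -> R[i]) :
  normc (\sum_(i <- r) F i) <= \sum_(i <- r) normc (F i).
Proof.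
elim: r => [|i r IH]; first by rewrite !big_nil normc0.
by rewrite !big_cons (le_trans (normcD_le _ _))// lerD2l.
Qed.

Lemma normc_real x : normc x%:C = `|x|.
Proof. by rewrite /= expr0n addr0 sqrtr_sqr. Qed.

Lemma normcX z n : normc (z ^+ n) = normc z ^+ n.
Proof. by elim: n => [|n IH]; rewrite ?expr0 ?normc1// !exprS normcM IH. Qed.

Lemma normc_sqr z : normc z ^+ 2 = Re z ^+ 2 + Im z ^+ 2.
Proof. by case: z => a b /=; rewrite sqr_sqrtr// addr_ge0 ?sqr_ge0. Qed.

Lemma normRe_le z : `|Re z| <= normc z.
Proof.
case: z => a b /=; rewrite -sqrtr_sqr.
by rewrite ler_wsqrtr// lerDl sqr_ge0.
Qed.

Lemma normIm_le z : `|Im z| <= normc z.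
Proof.
case: z => a b /=; rewrite -sqrtr_sqr.
by rewrite ler_wsqrtr// lerDr sqr_ge0.
Qed.

Lemma Im_le_normc z : Im z <= normc z.
Proof. exact: le_trans (ler_norm _) (normIm_le z). Qed.

Lemma ReD z w : Re (z + w) = Re z + Re w. Proof. by case: z w => a b []. Qed.
Lemma ImD z w : Im (z + w) = Im z + Im w. Proof. by case: z w => a b []. Qed.
Lemma ReN z : Re (- z) = - Re z. Proof. by case: z. Qed.
Lemma ImN z : Im (- z) = - Im z. Proof. by case: z. Qed.
Lemma ReZ x z : Re (x%:C * z) = x * Re z.
Proof. by case: z => a b /=; rewrite mul0r subr0. Qed.
Lemma ImZ x z : Im (x%:C * z) = x * Im z.
Proof. by case: z => a b /=; rewrite mul0r addr0. Qed.

Lemma Re_sum (I : Type) (r : seq I) (F : I -> R[i]) :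
  Re (\sum_(i <- r) F i) = \sum_(i <- r) Re (F i).
Proof. by elim: r => [|i r IH]; rewrite ?big_nil// !big_cons ReD IH. Qed.

Lemma Im_sum (I : Type) (r : seq I) (F : I -> R[i]) :
  Im (\sum_(i <- r) F i) = \sum_(i <- r) Im (F i).
Proof. by elim: r => [|i r IH]; rewrite ?big_nil// !big_cons ImD IH. Qed.

Lemma eqC_ReIm z w : Re z = Re w -> Im z = Im w -> z = w.
Proof. by case: z w => a b [c d] /= -> ->. Qed.

Lemma normc_gt0 z : z != 0 -> 0 < normc z.
Proof.
by move=> z0; rewrite lt_neqAle normc_ge0 andbT eq_sym; apply/eqP => zE; move: z0; rewrite (eq0_normc zE) eqxx.
Qed.

Lemma Im_inv z : Im z^-1 = - Im z / normc z ^+ 2.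
Proof. by rewrite normc_sqr mulNr; case: z. Qed.

Lemma Re_inv z : Re z^-1 = Re z / normc z ^+ 2.
Proof. by rewrite normc_sqr; case: z. Qed.

Lemma Im_gt0_neq0 z : 0 < Im z -> z != 0.
Proof. by move=> z0; apply/eqP => zE; move: z0; rewrite zE/= ltxx. Qed.

Lemma ImBr z x : Im (z - x%:C) = Im z.
Proof. by case: z => a b /=; rewrite subr0. Qed.

Lemma Im_gt0_neq_real z x : 0 < Im z -> z != x%:C.
Proof. by move=> z0; rewrite -subr_eq0 Im_gt0_neq0// ImBr. Qed.

End complex_modulus.

(** * Resolvents of Hermitian arrowhead matrices *)

Section spectral_step.
Context {R : realType}.
Local Notation C := R[i].

(** A list of pairs stands for a finitely supported measure: the first
    component is a mass, the second one its location. *)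
Definition cauchy_sum (l : seq (R * R)) (z : C) : C :=
  \sum_(e <- l) e.1%:C / (z - e.2%:C).

Local Open Scope sesquilinear_scope.
(** Let A be the matrix with diagonal (x, p_1, ..., p_n), first row and first
    column given by the square roots of the masses a_j, and zeros elsewhere.
    The Schur complement formula says that the upper left entry of (z - A)^-1
    is 1 / (z - sum_j a_j / (z - p_j) - x). As A is Hermitian, a unitary
    diagonalization of A writes this entry as sum_j m_j / (z - q_j), where
    q_j are the eigenvalues and m_j the squared moduli of the entries of the
    unitary matrix in its first column. Only eigenvalues of positive mass are
    kept. Under the hypotheses on z the first column v of the resolvent is
    explicit, and in the diagonalizing basis the equation satisfied by v has
    no solution at a kept eigenvalue, which gives the first conclusion. The
    point z may be real: the study of gaps relies on this. *)
Lemma arrowhead_spectral (l : seq (R * R)) (x : R) :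
  (forall e, e \in l -> 0 < e.1) ->
  exists m : seq (R * R), [/\ forall e, e \in m -> 0 < e.1,
    \sum_(e <- m) e.1 = 1 &
    forall z : C, (forall e, e \in l -> z != e.2%:C) ->
      z - cauchy_sum l z != x%:C ->
      (forall e, e \in m -> z != e.2%:C) /\
      cauchy_sum m z = (z - cauchy_sum l z - x%:C)^-1].
Proof.
move=> lpos; pose n := size l.
pose a (i : 'I_n) : C := (Num.sqrt (nth 0 l i).1)%:C.
pose la (i : 'I_n) : C := (nth 0 l i).2%:C.
have aa i : a i * a i = (nth 0 l i).1%:C.
  by rewrite -rmorphM -expr2 sqr_sqrtr// ltW// lpos// mem_nth.
(* square roots, so that the products of symmetric entries are the masses *)
pose A : 'M[C]_(1 + n) :=
  block_mx (x%:C)%:M (\row_i a i) (\col_i a i) (diag_mx (\row_i la i)).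
have Aherm : A \is hermsymmx.
  apply: realsym_hermsym.
    apply/is_hermitianmxP; rewrite expr0 scale1r map_mx_id//.
    rewrite /A tr_block_mx tr_scalar_mx tr_diag_mx; congr block_mx;
      by apply/matrixP => i j; rewrite !mxE.
  apply/mxOverP => i j; rewrite /A.
  have rC (y : R) : (y%:C : C) \is Num.real by apply/complex_realP; exists y.
  have sC (b : bool) (y : R) : (y%:C *+ b : C) \is Num.real.
    by case: b; rewrite ?mulr0n ?mulr1n// real0.
  case: (fintype.split_ordP i) => i' ->; case: (fintype.split_ordP j) => j' ->;
    rewrite ?(block_mxEul, block_mxEur, block_mxEdl, block_mxEdr) !mxE ?mulr1n; (exact: rC || exact: sC).
pose P := spectralmx A; pose D := spectral_diag A.
have Punit : P \in unitmx by exact: spectral_unit.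
have PV : invmx P = P^t* by rewrite invmx_unitary// spectral_unitarymx.
have AE : A = invmx P *m diag_mx D *m P.
  by apply/orthomx_spectralP/hermitian_normalmx.
have Dreal j : D 0 j = (Re (D 0 j))%:C.
  have /mxOverP/(_ 0 j) := hermitian_spectral_diag_real Aherm.
  by move=> /RRe_real ->.
clearbody P D.
pose i0 : 'I_(1 + n) := lshift n 0.
pose p j : R := normc (P j i0) ^+ 2.
have pE j : (p j)%:C = Num.conj (P j i0) * P j i0.
  rewrite /p; case: (P j i0) => u v; apply: eqC_ReIm => /=; last by ring.
  by rewrite sqr_sqrtr ?addr_ge0 ?sqr_ge0//; ring.
pose m := [seq (p j, Re (D 0 j)) | j <- enum 'I_(1 + n) & P j i0 != 0].
have sum_m (F : R * R -> C) :
    \sum_(e <- m) F e = \sum_(j | P j i0 != 0) F (p j, Re (D 0 j)).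
  by rewrite big_map big_filter big_enum_cond.
exists m; split.
- by move=> e /mapP[j]; rewrite mem_filter => /andP[Pj _] ->; rewrite exprn_gt0// normc_gt0.
- apply: (@complexI R); rewrite rmorph_sum/= sum_m/= rmorph1.
  have := mulVmx Punit; rewrite PV => /matrixP/(_ i0 i0).
  rewrite !mxE eqxx mulr1n => <-; rewrite big_mkcond/=; apply: eq_bigr => j _.
  rewrite !mxE pE; case: eqVneq => [->|//]; by rewrite mulr0.
move=> z zl zx.
pose g : C := (z - cauchy_sum l z - x%:C)^-1.
have gE : (z - cauchy_sum l z - x%:C) * g = 1 by rewrite divff// subr_eq0.
(* the first column of the resolvent of A at z *)
pose v : 'cV[C]_(1 + n) := col_mx (\col_i g) (\col_i (a i / (z - la i) * g)).
have zla i : z - la i != 0 by rewrite subr_eq0; apply: zl; exact: mem_nth.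
have Av : (z%:M - A) *m v = col_mx (\col_i 1) 0.
  rewrite scalar_mx_block /A opp_block_mx add_block_mx mul_block_col.
  congr col_mx.
    apply/matrixP => i j; rewrite !mxE big_ord1 !mxE (ord1 i) (ord1 j) eqxx !mulr1n.
    rewrite -[RHS]gE mulrBl mulrBl; rewrite /cauchy_sum (big_nth 0) big_mkord.
    rewrite mulrBl -/n mulr_suml.
    under eq_bigr do rewrite !mxE add0r mulNr mulrA mulrA aa.
    by rewrite sumrN; ring.
  apply/matrixP => i j; rewrite !mxE big_ord1 !mxE add0r (bigD1 i)//= !mxE eqxx !mulr1n.
  rewrite big1 ?addr0; last first.
    by move=> k ki; rewrite !mxE eq_sym (negbTE ki) !mulr0n subr0 mul0r.
  by field; exact: zla.
pose u := P *m v.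
have uE j : (z - D 0 j) * u j 0 = P j i0.
  have : P *m ((z%:M - A) *m v) = (z%:M - diag_mx D) *m u.
    rewrite /u !mulmxA; congr (_ *m _); rewrite mulmxBr mulmxBl scalar_mxC.
    have -> : P *m A = diag_mx D *m P by rewrite AE !mulmxA mulmxV// mul1mx.
    by [].
  have -> : ((z%:M - diag_mx D) *m u) = \matrix_(i, k) ((z - D 0 i) * u i k).
    by rewrite mulmxBl mul_scalar_mx mul_diag_mx; apply/matrixP => i k; rewrite !mxE mulrBl.
  rewrite Av => /matrixP/(_ j 0); rewrite [RHS]mxE => <-; rewrite mxE.
  rewrite big_split_ord/= big_ord1 big1 ?addr0 => [|k _]; last first.
    by rewrite col_mxEd mxE mulr0.
  rewrite col_mxEu mxE mulr1; congr (P j _); exact: val_inj.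
have zD j : P j i0 != 0 -> z - D 0 j != 0.
  by rewrite -uE; apply: contraNneq => ->; rewrite mul0r.
split.
  move=> e /mapP[j]; rewrite mem_filter => /andP[Pj _] ->/=.
  by rewrite -Dreal -subr_eq0 zD.
rewrite /cauchy_sum sum_m/=.
have : v i0 0 = g by rewrite /v col_mxEu mxE.
rewrite -/g => <-.
have -> : v = invmx P *m u by rewrite /u mulKmx.
move: {Av v} u uE => u uE.
rewrite !mxE big_mkcond/=; apply: eq_bigr => j _; rewrite PV !mxE.
case: eqVneq => [Pj|/= Pj]; first by rewrite Pj conjC0 mul0r.
by rewrite pE -Dreal -{2}uE; field; exact: zD.
Qed.
End spectral_step.

(** * Limits of complex sequences along a filter of indices *)

Section complex_limits.
Context {R : realType}.
Implicit Types (u v : nat -> R[i]) (z w : R[i]) (F : set_system nat).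

(** Convergence is expressed with the real-valued modulus, so that the theory
    of limits in the reals applies. *)
Definition cvgC F u w := normc (u n - w) @[n --> F] --> (0 : R).

Lemma cvgC_squeeze F u w (b : nat -> R) : Filter F ->
  (\forall n \near F, normc (u n - w) <= b n) -> b n @[n --> F] --> (0 : R) -> cvgC F u w.
Proof.
move=> FF ub b0; apply: squeeze_cvgr (cvg_cst 0) b0.
by apply: filterS ub => n ->; rewrite normc_ge0.
Qed.

Lemma cvgC_ReIm F u w : Filter F -> Re (u n) @[n --> F] --> Re w ->
  Im (u n) @[n --> F] --> Im w -> cvgC F u w.
Proof.
move=> FF uR uI.
have dR : `|Re (u n) - Re w| @[n --> F] --> (0 : R).
  by rewrite -[X in _ --> X](normr0 R); apply: cvg_norm; rewrite -(subrr (Re w)); apply: cvgB => //; exact: cvg_cst.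
have dI : `|Im (u n) - Im w| @[n --> F] --> (0 : R).
  by rewrite -[X in _ --> X](normr0 R); apply: cvg_norm; rewrite -(subrr (Im w)); apply: cvgB => //; exact: cvg_cst.
apply: (@cvgC_squeeze F u w (fun n => `|Re (u n) - Re w| + `|Im (u n) - Im w|)).
  apply: nearW => n; rewrite -!normc_real.
  have -> : u n - w = (Re (u n) - Re w)%:C + 'i%C * (Im (u n) - Im w)%:C.
    by case: (u n) => a b; case: (w) => c d; apply: eqC_ReIm => /=; ring.
  apply: le_trans (normcD_le _ _) _; rewrite lerD2l normcM.
  by rewrite [X in X * _]/= expr0n expr1n/= add0r sqrtr1 mul1r.
by rewrite -[X in _ --> X](addr0 0); exact: cvgD.
Qed.

Lemma cvgC_Re F u w : Filter F -> cvgC F u w -> Re (u n) @[n --> F] --> Re w.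
Proof.
move=> FF uw; apply/cvgrPdistC_le => e e0.
have /cvgrPdistC_le/(_ e e0) := uw; apply: filterS => n.
rewrite subr0 ger0_norm ?normc_ge0// => /(le_trans _); apply.
by rewrite -ReN -ReD normRe_le.
Qed.

Lemma cvgC_Im F u w : Filter F -> cvgC F u w -> Im (u n) @[n --> F] --> Im w.
Proof.
move=> FF uw; apply/cvgrPdistC_le => e e0.
have /cvgrPdistC_le/(_ e e0) := uw; apply: filterS => n.
rewrite subr0 ger0_norm ?normc_ge0// => /(le_trans _); apply.
by rewrite -ImN -ImD normIm_le.
Qed.

Lemma cvgC_cst F w : Filter F -> cvgC F (fun=> w) w.
Proof. by move=> FF; rewrite /cvgC subrr normc0; exact: cvg_cst. Qed.

Lemma cvgC_unique F u w1 w2 : ProperFilter F -> cvgC F u w1 -> cvgC F u w2 -> w1 = w2.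
Proof.
move=> FF h1 h2; apply: eqC_ReIm.
  by apply: cvg_unique (cvgC_Re _ h1) (cvgC_Re _ h2).
by apply: cvg_unique (cvgC_Im _ h1) (cvgC_Im _ h2).
Qed.

Lemma cvgCD F u v w z : Filter F -> cvgC F u w -> cvgC F v z -> cvgC F (fun n => u n + v n) (w + z).
Proof.
move=> FF uw vz; apply: (@cvgC_squeeze _ _ _ (fun n => normc (u n - w) + normc (v n - z))).
  by apply: nearW => n; rewrite opprD addrACA normcD_le.
by rewrite -[X in _ --> X](addr0 0); exact: cvgD.
Qed.

Lemma cvgCZ F u w z : Filter F -> cvgC F u w -> cvgC F (fun n => z * u n) (z * w).
Proof.
move=> FF uw; apply: (@cvgC_squeeze _ _ _ (fun n => normc z * normc (u n - w))).
  by apply: nearW => n; rewrite -mulrBr normcM.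
by rewrite -[X in _ --> X](mulr0 (normc z)); apply: cvgM => //; exact: cvg_cst.
Qed.

Lemma cvgCN F u w : Filter F -> cvgC F u w -> cvgC F (fun n => - u n) (- w).
Proof.
move=> FF; apply: cvg_trans; apply: near_eq_cvg; apply: nearW => n.
by rewrite -opprD normc_opp.
Qed.

Lemma cvgC_normc_le F u w (B : R) : ProperFilter F -> cvgC F u w ->
  (\forall n \near F, normc (u n) <= B) -> normc w <= B.
Proof.
move=> FF uw uB.
have : normc (u n - w) + B @[n --> F] --> 0 + B by apply: cvgD => //; exact: cvg_cst.
rewrite add0r => /cvgr_to_ge; apply; apply: filterS uB => n unB.
rewrite -[w](subrK (u n)) (le_trans (normcD_le _ _))// normcB.
by rewrite subrK lerD.
Qed.

(** Real and imaginary parts are sums of absolutely convergent series. *)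
Lemma bounded_variation_cvgC u (B : R) :
  (forall n, \sum_(i < n) normc (u i.+1 - u i) <= B) -> exists w, cvgC \oo u w.
Proof.
move=> uB.
have key (p : R[i] -> R) : (forall z w, p (z - w) = p z - p w) ->
    (forall z, `|p z| <= normc z) -> cvgn (p \o u).
  move=> pB pn.
  have : cvgn (series (fun n => p (u n.+1) - p (u n))).
    apply: (@normed_cvg R R).
    change (cvgn (series (fun n => `|p (u n.+1) - p (u n)| : R))).
    apply: nondecreasing_is_cvgn.
      by apply: nondecreasing_series => n _ _; exact: normr_ge0.
    exists B => _ [n _ <-]; apply: le_trans (uB n).
    by rewrite seriesEord/= ler_sum// => i _; rewrite -pB pn.
  have -> : series (fun n => p (u n.+1) - p (u n)) = (fun n => (p \o u) n - p (u 0)).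
    by apply/funext => n; rewrite /series/= telescope_sumr.
  move=> h; have -> : p \o u = (fun n => ((p \o u) n - p (u 0)) + p (u 0)).
    by apply/funext => n; rewrite subrK.
  by apply: is_cvgD => //; exact: is_cvg_cst.
have cR := key (@complex.Re R) (fun z w => ltac:(by rewrite ReD ReN)) (@normRe_le R).
have cI := key (@complex.Im R) (fun z w => ltac:(by rewrite ImD ImN)) (@normIm_le R).
exists (limn (@complex.Re R \o u) +i* limn (@complex.Im R \o u)).
exact: cvgC_ReIm.
Qed.

End complex_limits.

(** * Rational approximants of the reciprocal Cauchy transform *)

Section rational_pick.
Context {R : realType}.
Variables (c x : nat -> R).

Definition pick_sum n (w : R[i]) : R[i] := \sum_(k < n) (c k)%:C / (w - (x k)%:C).

Lemma normc_inv_le (w : R[i]) (h t : R) : 0 < h -> h <= Im w ->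
  normc (w - t%:C)^-1 <= h^-1.
Proof.
move=> h0 hw; rewrite normcV lef_pV2 ?posrE//.
  by rewrite (le_trans hw)// -(ImBr w t) Im_le_normc.
by rewrite normc_gt0// Im_gt0_neq0// ImBr (lt_le_trans h0).
Qed.

Hypothesis c_gt0 : forall k, 0 < c k.
Variable S : R.
Hypothesis c_sum : forall n, \sum_(k < n) c k <= S.

Lemma sum_bound_ge0 : 0 <= S.
Proof. by rewrite (le_trans _ (c_sum 0))// big_ord0. Qed.

Lemma pick_sum_le n w h : 0 < h -> h <= Im w -> normc (pick_sum n w) <= S / h.
Proof.
move=> h0 hw; rewrite (le_trans (normc_sum _ _))//.
apply: (@le_trans _ _ ((\sum_(k < n) c k) / h)).
  rewrite mulr_suml ler_sum// => k _; rewrite normcM normc_real gtr0_norm//.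
  by rewrite ler_pM2l// normc_inv_le.
by rewrite ler_pM2r ?invr_gt0.
Qed.

Lemma pick_sum_lip n w1 w2 h : 0 < h -> h <= Im w1 -> h <= Im w2 ->
  normc (pick_sum n w1 - pick_sum n w2) <= S / h ^+ 2 * normc (w1 - w2).
Proof.
move=> h0 h1 h2; rewrite -sumrB (le_trans (normc_sum _ _))//.
apply: (@le_trans _ _ ((\sum_(k < n) c k) / h ^+ 2 * normc (w1 - w2))); last first.
  by rewrite ler_wpM2r ?normc_ge0// ler_pM2r ?invr_gt0 ?exprn_gt0.
rewrite -mulrA mulr_suml ler_sum// => k _.
have n1 : w1 - (x k)%:C != 0 by rewrite Im_gt0_neq0// ImBr (lt_le_trans h0).
have n2 : w2 - (x k)%:C != 0 by rewrite Im_gt0_neq0// ImBr (lt_le_trans h0).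
have -> : (c k)%:C / (w1 - (x k)%:C) - (c k)%:C / (w2 - (x k)%:C) =
   (c k)%:C * ((w1 - (x k)%:C)^-1 * (w2 - (x k)%:C)^-1 * (w2 - w1)) by field; rewrite n1 n2.
rewrite normcM normc_real gtr0_norm// ler_pM2l// normcM [normc (w2 - _)]normcB.
rewrite ler_wpM2r ?normc_ge0// normcM expr2 invfM ler_pM ?normc_ge0 ?normc_inv_le//.
Qed.

(** The measure whose Cauchy transform is the resolvent at t of the
    reciprocal Cauchy transform z - cauchy_sum l z. *)
Definition resolvent_mass (l : seq (R * R)) (t : R) : seq (R * R) :=
  if pselect (forall e, e \in l -> 0 < e.1) is left l0
  then projT1 (cid (arrowhead_spectral t l0)) else [::].

Lemma resolvent_massP l t : (forall e, e \in l -> 0 < e.1) ->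
  [/\ forall e, e \in resolvent_mass l t -> 0 < e.1,
    \sum_(e <- resolvent_mass l t) e.1 = 1 &
    forall z : R[i], (forall e, e \in l -> z != e.2%:C) ->
      z - cauchy_sum l z != t%:C ->
      (forall e, e \in resolvent_mass l t -> z != e.2%:C) /\
      cauchy_sum (resolvent_mass l t) z = (z - cauchy_sum l z - t%:C)^-1].
Proof.
move=> l0; rewrite /resolvent_mass; case: pselect => // l0'.
exact: projT2 (cid (arrowhead_spectral t l0')).
Qed.

(** The poles p_j of F_n with their masses a_j, for
    F_n z = z - sum_j a_j / (z - p_j). The recursion uses only the poles x k
    with k < n at step n, so that every F_n is rational. *)
Fixpoint poles n : seq (R * R) := if n is n'.+1 then
    flatten [seq [seq (c k * e.1, e.2) | e <- resolvent_mass (poles n') (x k)] | k <- iota 0 n']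
  else [::].

Definition iterF n z := z - cauchy_sum (poles n) z.

Lemma poles_gt0 n e : e \in poles n -> 0 < e.1.
Proof.
elim: n e => [//|n IH] e /flattenP[_ /mapP[k _ ->]] /mapP[e' e'in ->]/=.
have [h _ _] := resolvent_massP (x k) IH.
by rewrite mulr_gt0// h.
Qed.

Lemma iterF_Im n z : 0 < Im z -> Im z <= Im (iterF n z).
Proof.
move=> z0; rewrite ImD lerDl ImN oppr_ge0 Im_sum big_seq sumr_le0// => e en.
rewrite ImZ Im_inv ImBr mulNr mulrN oppr_le0 mulr_ge0//; first exact/ltW/(@poles_gt0 n).
by rewrite divr_ge0 ?sqr_ge0// ltW.
Qed.

(** Stated at every complex number, real ones included, at which no
    denominator vanishes. *)
Lemma iterFS n z : (forall e, e \in poles n -> z != e.2%:C) ->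
  (forall k, (k < n)%N -> iterF n z != (x k)%:C) ->
  (forall e, e \in poles n.+1 -> z != e.2%:C) /\
  iterF n.+1 z = z - pick_sum n (iterF n z).
Proof.
move=> zn zx; split.
  move=> _ /flattenP[_ /mapP[k kn ->]] /mapP[e' e'in ->]/=.
  have [_ _ /(_ z zn)] := resolvent_massP (x k) (@poles_gt0 n).
  by move=> /(_ (zx k _)) []; [by rewrite mem_iota in kn|move=> + _; apply].
rewrite /iterF /cauchy_sum/= big_flatten big_map/=; congr (_ - _).
rewrite /pick_sum -(big_mkord xpredT (fun k => (c k)%:C / (iterF n z - (x k)%:C))).
rewrite /index_iota subn0 [LHS]big_seq [RHS]big_seq.
apply: eq_bigr => k kn; rewrite big_map/=.
have [_ _ /(_ z zn)] := resolvent_massP (x k) (@poles_gt0 n).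
move=> /(_ (zx k _)) [|_]; first by rewrite mem_iota in kn.
rewrite -/(iterF n z) => <-; rewrite /cauchy_sum mulr_sumr; apply: eq_bigr => e _.
by rewrite rmorphM mulrA.
Qed.

Lemma iterFS_Im n z : 0 < Im z -> iterF n.+1 z = z - pick_sum n (iterF n z).
Proof.
move=> z0; apply: (iterFS _ _).2 => [e _|k _]; apply: Im_gt0_neq_real => //.
by rewrite (lt_le_trans z0)// iterF_Im.
Qed.

Definition approx_mass n := resolvent_mass (poles n) 0.

Lemma approx_mass_gt0 n e : e \in approx_mass n -> 0 < e.1.
Proof. by have [h _ _] := resolvent_massP 0 (@poles_gt0 n); exact: h. Qed.

Lemma approx_mass_sum n : \sum_(e <- approx_mass n) e.1 = 1.
Proof. by have [_ h _] := resolvent_massP 0 (@poles_gt0 n). Qed.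

Lemma approx_massE n z : 0 < Im z -> cauchy_sum (approx_mass n) z = (iterF n z)^-1.
Proof.
move=> z0; have [_ _ /(_ z)] := resolvent_massP 0 (@poles_gt0 n).
move=> /(_ (fun e _ => Im_gt0_neq_real e.2 z0)) [|_].
  by apply: Im_gt0_neq_real; rewrite (lt_le_trans z0) ?iterF_Im.
by rewrite /approx_mass => ->; rewrite subr0.
Qed.

(** If L is the distance from t to the poles, F_n t stays at distance at least
    L - 1 >= S from them, and the next correction is at most S / (L - 1) <= 1. *)
Lemma iterF_gap (L t : R) n : 1 < L -> S <= L - 1 -> (forall k, L <= `|t - x k|) ->
  (forall e, e \in poles n -> t%:C != e.2%:C :> R[i]) /\ normc (iterF n t%:C - t%:C) <= 1.
Proof.
move=> L1 SL tx; elim: n => [|n [IH1 IH2]].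
  by split => //; rewrite /iterF /cauchy_sum big_nil subr0 subrr normc0.
(* the current iterate is still far from every pole *)
have far k : L - 1 <= normc (iterF n t%:C - (x k)%:C).
  rewrite lerBlDr (le_trans (tx k))// -normc_real rmorphB/=.
  have := normcD_le (t%:C - iterF n t%:C) (iterF n t%:C - (x k)%:C).
  by rewrite addrA subrK normcB => /le_trans; apply; rewrite addrC lerD2l normcB normcB.
have L0 : 0 < L - 1 by rewrite subr_gt0.
have nx k : iterF n t%:C != (x k)%:C.
  by apply/eqP => E; have := lt_le_trans L0 (far k); rewrite E subrr normc0 ltxx.
have [h ->] := iterFS IH1 (fun k _ => nx k); split => //.
rewrite addrAC subrr add0r normc_opp (le_trans (normc_sum _ _))//.
apply: (@le_trans _ _ ((\sum_(k < n) c k) / (L - 1))).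
  rewrite mulr_suml ler_sum// => k _; rewrite normcM normc_real gtr0_norm//.
  by rewrite ler_pM2l// normcV lef_pV2 ?posrE// (lt_le_trans L0).
by rewrite ler_pdivrMr// mul1r (le_trans (c_sum _)).
Qed.

(** An atom t would be a zero of F_n, while F_n t is within distance 1 of t. *)
Lemma approx_mass_gap (L t : R) n : 1 < L -> S <= L - 1 -> (forall k, L <= `|t - x k|) ->
  1 < `|t| -> forall e, e \in approx_mass n -> e.2 != t.
Proof.
move=> L1 SL tx t1 e en; have [h1 h2] := iterF_gap n L1 SL tx.
have [_ _ /(_ t%:C h1)] := resolvent_massP 0 (@poles_gt0 n).
case=> [|/(_ e en) + _]; last by apply: contra => /eqP ->.
apply/eqP => E; move: h2; rewrite [iterF _ _]E sub0r normc_opp normc_real.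
by rewrite leNgt t1.
Qed.

End rational_pick.

(** * Convergence of the approximants in a half-plane *)

Section fixed_point.
Context {R : realType}.
Variables (c x : nat -> R) (S : R) (phi : R[i] -> R[i]).
Hypothesis c_gt0 : forall k, 0 < c k.
Hypothesis c_sum : forall n, \sum_(k < n) c k <= S.
Hypothesis phi_lim : forall w, 0 < Im w -> cvgC \oo (fun n => pick_sum c x n w) (phi w).

(** On the half-plane of height Im z the map w |-> z - pick_sum c x n w is
    1/2-Lipschitz, and increasing n by one perturbs it by at most c n; hence
    the increments of the iterates are summable. *)
Lemma iterF_cvg (z : R[i]) : 1 <= Im z -> 2 * S <= Im z ^+ 2 ->
  exists w, [/\ cvgC \oo (fun n => iterF c x n z) w, Im z <= Im w & w + phi w = z].
Proof.
move=> z1 zS; have z0 : 0 < Im z by apply: lt_le_trans z1.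
pose h := Im z; pose u n := iterF c x n z.
have hu n : h <= Im (u n) by exact: iterF_Im.
have uS n : u n.+1 = z - pick_sum c x n (u n) by rewrite /u iterFS_Im.
have hh : S / h ^+ 2 <= 2^-1.
  by rewrite ler_pdivrMr ?exprn_gt0// mulrC ler_pdivlMr// mulrC.
pose d n := normc (u n.+1 - u n).
have d0 : d 0 = 0.
  by rewrite /d uS /u /iterF /cauchy_sum /pick_sum !big_nil big_ord0 subrr normc0.
have dS n : d n.+1 <= 2^-1 * d n + c n.
  have -> : d n.+1 = normc ((pick_sum c x n (u n) - pick_sum c x n (u n.+1))
                            + - ((c n)%:C / (u n.+1 - (x n)%:C))).
    rewrite /d (uS n.+1) [X in _ - X](uS n); congr normc.
    by rewrite /pick_sum big_ord_recr/=; ring.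
  rewrite (le_trans (normcD_le _ _))// lerD//.
    rewrite (le_trans (pick_sum_lip x c_gt0 c_sum n z0 (hu n) (hu n.+1)))//.
    by rewrite [normc (u n - _)]normcB ler_wpM2r ?normc_ge0.
  rewrite normc_opp normcM normc_real gtr0_norm// ler_piMr ?(ltW (c_gt0 _))//.
  by rewrite (le_trans (normc_inv_le _ z0 (hu _)))// invf_le1.
have dsum n : \sum_(i < n) d i <= 2 * S.
  elim: n => [|n IH]; first by rewrite big_ord0; apply: mulr_ge0 => //; exact: sum_bound_ge0 c_sum.
  rewrite big_ord_recl d0 add0r.
  apply: (@le_trans _ _ (\sum_(i < n) (2^-1 * d i + c i))).
    by apply: ler_sum => i _; exact: dS.
  rewrite big_split/= -mulr_sumr; have := c_sum n; lra.
have [w uw] := bounded_variation_cvgC dsum; exists w.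
have hw : h <= Im w by apply: (cvgr_to_ge (cvgC_Im _ uw)); exact: nearW.
split => //.
have w0 : 0 < Im w by apply: lt_le_trans hw.
have h0 : 0 < h by [].
have uw1 : cvgC \oo (fun n => u n.+1) w by move: uw; rewrite /cvgC -(cvg_shiftS (fun n => normc (u n - w))).
have pw : cvgC \oo (fun n => pick_sum c x n (u n)) (phi w).
  apply: (@cvgC_squeeze _ _ _ _ (fun n => S / h ^+ 2 * normc (u n - w) + normc (pick_sum c x n w - phi w))).
    apply: nearW => n; rewrite -[X in X - phi w](subrK (pick_sum c x n w)) -addrA.
    by rewrite (le_trans (normcD_le _ _))// lerD// (pick_sum_lip x c_gt0 c_sum).
  rewrite -[X in _ --> X](addr0 0); apply: cvgD; last exact: phi_lim.
  by rewrite -[X in _ --> X](mulr0 (S / h ^+ 2)); apply: cvgM => //; exact: cvg_cst.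
suff /(cvgC_unique _ uw1) E : cvgC \oo (fun n => u n.+1) (z - phi w).
  by rewrite [X in X + _]E subrK.
rewrite (_ : (fun n => _) = (fun n => z - pick_sum c x n (u n))); last exact/funext.
by apply: cvgCD; [exact: cvgC_cst|exact: cvgCN].
Qed.

Lemma phi_lip w1 w2 h : 0 < h -> h <= Im w1 -> h <= Im w2 ->
  normc (phi w1 - phi w2) <= S / h ^+ 2 * normc (w1 - w2).
Proof.
move=> h0 h1 h2.
apply: (cvgC_normc_le _ (cvgCD _ (phi_lim (lt_le_trans h0 h1)) (cvgCN _ (phi_lim (lt_le_trans h0 h2))))).
apply: nearW => n; exact: (pick_sum_lip x c_gt0 c_sum).
Qed.

Lemma phi_le w h : 0 < h -> h <= Im w -> normc (phi w) <= S / h.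
Proof.
move=> h0 h1; apply: cvgC_normc_le _ (phi_lim (lt_le_trans h0 h1)) _.
by apply: nearW => n; exact: (pick_sum_le _ c_gt0 c_sum).
Qed.

End fixed_point.

(** * Integrals against a probability measure on the line *)

Section probability_from_cdf.
Context {R : realType}.

Lemma probability_of_cdf (F : R -> R) : nondecreasing F -> right_continuous F ->
  F @ -oo --> (0 : R) -> F @ +oo --> (1 : R) ->
  exists P : probability (measurableTypeR R) R,
    forall a b, a <= b -> P `]a, b]%classic = (F b - F a)%:E.
Proof.
move=> Fnd Frc F0 F1.
pose G : cumulativeBounded (0 : R) (1 : R) := HB.pack_for (cumulativeBounded 0 1) F
  (isCumulative.Build R _ R F Fnd Frc) (isCumulativeBounded.Build R 0 1 F F0 F1).
exists (lebesgue_stieltjes_measure G : probability _ _) => a b ab.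
rewrite /= /lebesgue_stieltjes_measure /measure_extension measurable_mu_extE/=.
  by rewrite wlength_itv_bnd.
exact: is_ocitv.
Qed.

End probability_from_cdf.

Section step_approximation.
Context {R : realType}.

Definition step_fun (f : R -> R) (t : nat -> R) m (x : R) : R :=
  \sum_(i < m) f (t i) * \1_(`]t i, t i.+1]%classic) x.

Lemma step_fun_out f t m x : nondecreasing_seq t -> ~ (t 0 < x <= t m) -> step_fun f t m x = 0.
Proof.
move=> tnd xout; rewrite /step_fun big1// => i _.
rewrite indicE memNset ?mulr0//= in_itv/= => /andP[h1 h2]; apply: xout.
by rewrite (le_lt_trans (tnd _ _ (leq0n i)) h1) (le_trans h2)// tnd.
Qed.

Lemma step_fun_in f t m x (h lam : R) : nondecreasing_seq t -> 0 <= lam ->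
  (forall i, t i.+1 - t i <= h) ->
  (forall y z, `|f y - f z| <= lam * `|y - z|) ->
  t 0 < x <= t m -> `|f x - step_fun f t m x| <= lam * h.
Proof.
move=> tnd lam0 th fl; elim: m => [/andP[h1 h2]|m IH /andP[x0 xm]].
  by have := lt_le_trans h1 h2; rewrite ltxx.
rewrite /step_fun big_ord_recr/= -/(step_fun f t m x).
have [xtm|tmx] := leP x (t m).
  rewrite indicE memNset ?mulr0 ?addr0; first by rewrite IH ?x0.
  by rewrite /= in_itv/= => /andP[]; rewrite ltNge xtm.
rewrite step_fun_out//; last by move=> /andP[_]; rewrite leNgt tmx.
rewrite indicE mem_set ?mulr1 ?add0r/= ?in_itv/= ?tmx//.
rewrite (le_trans (fl _ _))// ler_wpM2l// gtr0_norm ?subr_gt0//.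
by rewrite (le_trans _ (th m))// lerD2r.
Qed.

(** On a cell of the grid f varies by at most lam * h; outside the grid the
    step function vanishes, which is the reason for the second term. *)
Lemma step_fun_close f t m x (h lam B : R) : nondecreasing_seq t -> 0 <= lam ->
  (forall i, t i.+1 - t i <= h) -> (forall y, `|f y| <= B) ->
  (forall y z, `|f y - f z| <= lam * `|y - z|) ->
  `|f x - step_fun f t m x| <= lam * h + B * (1 - \1_(`]t 0, t m]%classic) x).
Proof.
move=> tnd lam0 th fB fl; rewrite indicE.
have h0 : 0 <= h by rewrite (le_trans _ (th 0%N))// subr_ge0 tnd.
have B0 : 0 <= B by rewrite (le_trans _ (fB 0)).
have [xin|xout] := boolP (t 0 < x <= t m).
  by rewrite mem_set/= ?in_itv//= subrr mulr0 addr0 step_fun_in.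
rewrite step_fun_out//; last exact/negP.
rewrite memNset; last by move=> /=; rewrite in_itv/=; exact/negP.
by rewrite !subr0 mulr1 (le_trans (fB x))// lerDr mulr_ge0.
Qed.

Variable P : probability (measurableTypeR R) R.

Lemma bounded_integrable (f : R -> R) (B : R) : measurable_fun [set: measurableTypeR R] f ->
  (forall x, `|f x| <= B) -> P.-integrable setT (EFin \o f).
Proof.
move=> mf fB; apply: measurable_bounded_integrable => //.
  by apply: (@le_lt_trans _ _ 1%E); [exact: probability_le1|exact: ltry].
by exists B; split; [exact: num_real|move=> y yB x _; apply: le_trans (fB x) _; exact: ltW].
Qed.

Lemma lipschitz_measurable (f : R -> R) lam : (forall y z, `|f y - f z| <= lam * `|y - z|) ->
  measurable_fun [set: measurableTypeR R] f.
Proof.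
move=> fl; apply: continuous_measurable_fun => x; apply/cvgrPdist_le => e e0.
have l0 : 0 < `|lam| + 1 by rewrite ltr_wpDl.
near=> y; rewrite (le_trans (fl _ _))//.
rewrite (@le_trans _ _ ((`|lam| + 1) * `|x - y|))//.
  by rewrite ler_wpM2r// (le_trans (ler_norm _))// lerDl.
rewrite -ler_pdivlMl//; near: y; apply: cvgr_dist_le => //.
by rewrite mulr_gt0// invr_gt0.
Unshelve. all: by end_near. Qed.

Lemma Rintegral_indicP (A : set (measurableTypeR R)) : measurable A ->
  \int[P]_x (\1_A x) = fine (P A).
Proof. by move=> mA; rewrite /Rintegral integral_indic// setIT. Qed.

Let measurable_ocitv (a b : R) : measurable (`]a, b]%classic : set (measurableTypeR R)).
Proof. exact: measurable_itv. Qed.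

Lemma integrable_indicP (A : set (measurableTypeR R)) : measurable A ->
  P.-integrable setT (EFin \o (\1_A : measurableTypeR R -> R)).
Proof.
move=> mA; apply: (@bounded_integrable _ 1) => // x; rewrite indicE.
by case: (_ \in _); rewrite ?normr1 ?normr0.
Qed.

Lemma integrable_scale (f : R -> R) r : P.-integrable setT (EFin \o f) ->
  P.-integrable setT (EFin \o (fun x => r * f x)).
Proof. by move=> fi; exact: (integrableZl measurableT r fi). Qed.

Lemma integrable_step_fun f t m : P.-integrable setT (EFin \o step_fun f t m).
Proof.
elim: m => [|m IH].
  have -> : step_fun f t 0 = cst 0 by apply/funext => x; rewrite /step_fun big_ord0.
  exact: integrable0.
have -> : step_fun f t m.+1 = (fun x => step_fun f t m x + f (t m) * \1_(`]t m, t m.+1]%classic) x).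
  by apply/funext => x; rewrite /step_fun big_ord_recr.
exact: (integrableD measurableT IH (integrable_scale (f (t m)) (integrable_indicP (measurable_ocitv _ _)))).
Qed.

Lemma Rintegral_step_fun f t m :
  \int[P]_x (step_fun f t m x) = \sum_(i < m) f (t i) * fine (P `]t i, t i.+1]%classic).
Proof.
elim: m => [|m IH].
  by rewrite big_ord0; under eq_Rintegral do rewrite /step_fun big_ord0; rewrite Rintegral_cst// mul0r.
under eq_Rintegral do rewrite /step_fun big_ord_recr/= -/(step_fun f t m _).
rewrite RintegralD//; [|exact: integrable_step_fun|apply: integrable_scale; exact: integrable_indicP].
rewrite IH big_ord_recr/= RintegralZl//; last exact: integrable_indicP.
by rewrite Rintegral_indicP.
Qed.

Lemma fine_setT : fine (P setT) = 1.
Proof. by rewrite probability_setT. Qed.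

Lemma Rintegral_step_close f t m (h lam B : R) : nondecreasing_seq t -> 0 <= lam ->
  (forall i, t i.+1 - t i <= h) -> (forall y, `|f y| <= B) ->
  (forall y z, `|f y - f z| <= lam * `|y - z|) ->
  `|\int[P]_x f x - \sum_(i < m) f (t i) * fine (P `]t i, t i.+1]%classic)|
    <= lam * h + B * (1 - fine (P `]t 0, t m]%classic)).
Proof.
move=> tnd lam0 th fB fl.
have fi : P.-integrable setT (EFin \o f).
  by apply: bounded_integrable fB; exact: lipschitz_measurable fl.
have si := integrable_step_fun f t m.
have di : P.-integrable setT (EFin \o (fun x => f x - step_fun f t m x)).
  exact: (integrableB measurableT fi si).
pose I : set (measurableTypeR R) := `]t 0, t m]%classic.
have bi : P.-integrable setT (EFin \o (fun x => B * (1 - \1_I x))).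
  have c1 : P.-integrable setT (EFin \o (cst 1)).
    by apply: (@bounded_integrable (cst 1) 1) => // x; rewrite normr1.
  exact: (integrable_scale _ (integrableB measurableT c1 (integrable_indicP (measurable_ocitv _ _)))).
have ci : P.-integrable setT (EFin \o (cst (lam * h))).
  by apply: (@bounded_integrable (cst (lam * h)) `|lam * h|).
rewrite -Rintegral_step_fun -RintegralB//.
apply: le_trans (le_normr_Rintegral _ _) _ => //.
apply: (@le_trans _ _ (\int[P]_x (lam * h + B * (1 - \1_I x)))).
  apply: le_Rintegral => //.
  - exact: integrable_norm di.
  - exact: (integrableD measurableT ci bi).
  - by move=> x _; exact: step_fun_close.
rewrite RintegralD// Rintegral_cst// RintegralZl//; last first.
  have c1 : P.-integrable setT (EFin \o (cst 1)).
    by apply: (@bounded_integrable (cst 1) 1) => // x; rewrite normr1.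
  exact: (integrableB measurableT c1 (integrable_indicP (measurable_ocitv _ _))).
rewrite RintegralB//; last exact: (integrable_indicP (measurable_ocitv _ _)).
  by rewrite Rintegral_cst// Rintegral_indicP ?fine_setT ?mul1r ?mulr1//; exact: measurable_ocitv.
by apply: (@bounded_integrable (cst 1) 1) => // x; rewrite normr1.
Qed.

End step_approximation.

(** * Weak limits along an ultrafilter *)

Section ultrafilter_limits.
Context {R : realType}.

Lemma cvg_ord_sum (F : set_system nat) m (u : 'I_m -> nat -> R) (v : 'I_m -> R) : Filter F ->
  (forall i, u i n @[n --> F] --> v i) ->
  \sum_(i < m) u i n @[n --> F] --> \sum_(i < m) v i.
Proof.
move=> FF; elim: m u v => [|m IH] u v uv.
  by rewrite big_ord0 (_ : (fun n => _) = cst 0); [exact: cvg_cst|apply/funext => n; rewrite big_ord0].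
rewrite big_ord_recl (_ : (fun n => _) =
    (fun n => u ord0 n + \sum_(i < m) u (lift ord0 i) n)); last first.
  by apply/funext => n; rewrite big_ord_recl.
by apply: cvgD; [exact: uv|apply: IH => i; exact: uv].
Qed.

Lemma exists_ultrafilter : exists U : set_system nat, UltraFilter U /\ \oo `<=` U.
Proof. exact: ultraFilterLemma. Qed.

(** An ultrafilter converges to each of its cluster points. *)
Lemma ultra_bounded_cvg (U : set_system nat) (u : nat -> R) (B : R) : UltraFilter U ->
  (forall n, `|u n| <= B) -> cvg (u n @[n --> U]).
Proof.
move=> UU uB; have /(_ (fmap u U)) := @segment_compact R (- B) B.
case=> [|].
  by apply: nearW => n /=; rewrite in_itv/= -ler_norml uB.
move=> p [_ pcl]; apply/cvg_ex; exists p => N Np.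
have [//|UN] := in_ultra_setVsetC (u @^-1` N) UU.
by have [y []] := pcl (~` N) N UN Np.
Qed.

End ultrafilter_limits.

Section helly.
Context {R : realType}.
Variables (l : nat -> seq (R * R)) (K : R).
Hypothesis l_gt0 : forall n e, e \in l n -> 0 < e.1.
Hypothesis l_sum : forall n, \sum_(e <- l n) e.1 = 1.
Hypothesis l_tight : forall n y, 0 < y -> \sum_(e <- l n | y <= `|e.2|) e.1 <= K / y ^+ 2.
Variable U : set_system nat.
Hypothesis UU : UltraFilter U.

Definition dcdf n x : R := \sum_(e <- l n | e.2 <= x) e.1.

Lemma le_partial_mass n (p q : pred (R * R)) : (forall e, p e -> q e) ->
  \sum_(e <- l n | p e) e.1 <= \sum_(e <- l n | q e) e.1.
Proof.
move=> pq; rewrite big_mkcond [leRHS]big_mkcond/= big_seq [leRHS]big_seq.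
apply: ler_sum => e en; case: ifPn => [/pq ->//|_]; case: ifP => // _.
exact: ltW (l_gt0 en).
Qed.

Lemma dcdf_ge0 n x : 0 <= dcdf n x.
Proof. by rewrite /dcdf big_seq_cond sumr_ge0// => e /andP[/l_gt0/ltW]. Qed.

Lemma dcdf_le1 n x : dcdf n x <= 1.
Proof. by rewrite -(l_sum n); exact: le_partial_mass. Qed.

Lemma dcdf_nd n x y : x <= y -> dcdf n x <= dcdf n y.
Proof. by move=> xy; apply: le_partial_mass => e /le_trans; exact. Qed.

Lemma dcdf_left n y : 0 < y -> dcdf n (- y) <= K / y ^+ 2.
Proof.
move=> y0; apply: le_trans (l_tight n y0); apply: le_partial_mass => e ey.
by rewrite -normrN (le_trans _ (ler_norm _))// lerNr.
Qed.

Lemma dcdf_right n y : 0 < y -> 1 - dcdf n y <= K / y ^+ 2.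
Proof.
move=> y0; apply: le_trans (l_tight n y0).
rewrite -(l_sum n) (bigID (fun e : R * R => e.2 <= y))/= addrAC subrr add0r.
apply: le_partial_mass => e; rewrite -ltNge => /ltW ye.
by rewrite (le_trans ye)// ler_norm.
Qed.

(** The limit along U of the cumulative functions; it need not be
    right-continuous, which is why rcdf is introduced. *)
Definition ucdf x : R := lim (dcdf n x @[n --> U]).

Lemma ucdf_cvg x : dcdf n x @[n --> U] --> ucdf x.
Proof.
by apply: (@ultra_bounded_cvg _ _ _ 1) => n; rewrite ger0_norm ?dcdf_ge0 ?dcdf_le1.
Qed.

Lemma ucdf_ge0 x : 0 <= ucdf x.
Proof. by apply: (cvgr_to_ge (@ucdf_cvg x)); apply: nearW => n; exact: dcdf_ge0. Qed.

Lemma ucdf_le1 x : ucdf x <= 1.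
Proof. by apply: (cvgr_to_le (@ucdf_cvg x)); apply: nearW => n; exact: dcdf_le1. Qed.

Lemma ucdf_nd x y : x <= y -> ucdf x <= ucdf y.
Proof.
move=> xy; apply: (ler_cvg_to (@ucdf_cvg x) (@ucdf_cvg y)).
by apply: nearW => n; exact: dcdf_nd.
Qed.

Lemma ucdf_left y : 0 < y -> ucdf (- y) <= K / y ^+ 2.
Proof. by move=> y0; apply: (cvgr_to_le (@ucdf_cvg _)); apply: nearW => n; exact: dcdf_left. Qed.

Lemma ucdf_right y : 0 < y -> 1 - ucdf y <= K / y ^+ 2.
Proof.
move=> y0; rewrite lerBlDr addrC -lerBlDr; apply: (cvgr_to_ge (@ucdf_cvg _)).
by apply: nearW => n; rewrite lerBlDr addrC -lerBlDr; exact: dcdf_right.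
Qed.

Definition rcdf x : R := inf [set ucdf t | t in [set t | x < t]].

Let rcdf_has_inf x : has_inf [set ucdf t | t in [set t | x < t]].
Proof.
split; first by exists (ucdf (x + 1)), (x + 1) => //=; rewrite ltrDl.
by exists 0 => _ [t _ <-]; exact: ucdf_ge0.
Qed.

Lemma rcdf_le x t : x < t -> rcdf x <= ucdf t.
Proof. by move=> xt; apply: ge_inf; [exact: (rcdf_has_inf x).2|exists t]. Qed.

Lemma ucdf_le_rcdf x : ucdf x <= rcdf x.
Proof.
apply: lb_le_inf; first exact: (rcdf_has_inf x).1.
by move=> _ [t /= /ltW xt <-]; exact: ucdf_nd.
Qed.

Lemma rcdf_nd : nondecreasing rcdf.
Proof.
move=> x y xy; apply: lb_le_inf; first exact: (rcdf_has_inf y).1.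
by move=> _ [t /= yt <-]; apply: rcdf_le; exact: le_lt_trans yt.
Qed.

Lemma rcdf_le1 x : rcdf x <= 1.
Proof. by rewrite (le_trans (@rcdf_le x (x + 1) _)) ?ltrDl// ucdf_le1. Qed.

Lemma rcdf_left y : 0 < y -> rcdf (- y) <= 4 * K / y ^+ 2.
Proof.
move=> y0; have y2 : 0 < y / 2 by rewrite divr_gt0.
rewrite (le_trans (@rcdf_le _ (- (y / 2)) _)) ?ltrN2 ?ltr_pdivrMr ?ltr_pMr ?ltr1n//.
rewrite (le_trans (ucdf_left y2))// expr_div_n invf_div.
by rewrite (_ : 2 ^+ 2 = 4 :> R) ?mulrA 1?[K * 4]mulrC// -natrX.
Qed.

Lemma rcdf_right y : 0 < y -> 1 - rcdf y <= K / y ^+ 2.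
Proof. by move=> y0; rewrite (le_trans _ (ucdf_right y0))// lerD2l lerN2 ucdf_le_rcdf. Qed.

Lemma rcdf_rc : right_continuous rcdf.
Proof.
move=> x; apply/cvgrPdist_le => e e0.
have [_ [t /= xt <-] te] := inf_adherent e0 (rcdf_has_inf x).
near=> u; have xu : x <= u by near: u; exact: nbhs_right_ge.
rewrite ler0_norm ?subr_le0 ?rcdf_nd//.
rewrite opprB lerBlDl; apply: le_trans (ltW te); apply: rcdf_le.
by near: u; exact: nbhs_right_lt.
Unshelve. all: by end_near. Qed.

Let tail_small e : 0 < e -> exists2 y, 0 < y & 4 * K / y ^+ 2 <= e.
Proof.
move=> e0; pose y := 1 + `|4 * K / e|.
have y1 : 1 <= y by rewrite lerDl.
exists y; first exact: lt_le_trans y1.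
rewrite ler_pdivrMr ?exprn_gt0 ?(lt_le_trans _ y1)// [e * _]mulrC -ler_pdivrMr//.
have yk : `|4 * K / e| <= y by rewrite /y lerDr.
rewrite (le_trans (ler_norm _))// (le_trans yk)//.
by rewrite expr2 ler_peMr// (le_trans _ y1).
Qed.

Lemma rcdf_cvgNy : rcdf @ -oo --> (0 : R).
Proof.
apply/cvgrPdistC_le => e /tail_small[y y0 ye]; near=> x.
rewrite subr0 ger0_norm; last by rewrite (le_trans (ucdf_ge0 x))// ucdf_le_rcdf.
apply: le_trans ye; apply: le_trans (rcdf_left y0); apply: rcdf_nd.
by near: x; apply: nbhs_ninfty_le; exact: num_real.
Unshelve. all: by end_near. Qed.

Lemma K_ge0 : 0 <= K.
Proof.
by have := le_trans (dcdf_ge0 0 _) (dcdf_left 0 ltr01); rewrite expr1n divr1.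
Qed.

Lemma rcdf_cvgy : rcdf @ +oo --> (1 : R).
Proof.
apply/cvgrPdist_le => e /tail_small[y y0 ye]; near=> x.
rewrite ger0_norm ?subr_ge0 ?rcdf_le1//.
apply: (@le_trans _ _ (1 - rcdf y)).
  by rewrite lerD2l lerN2; apply: rcdf_nd; near: x; apply: nbhs_pinfty_ge; exact: num_real.
apply: le_trans (rcdf_right y0) _; apply: le_trans ye.
by rewrite -mulrA ler_peMl ?ler1n// mulr_ge0 ?K_ge0// invr_ge0 exprn_ge0// ltW.
Unshelve. all: by end_near. Qed.

Lemma dcdf_step (f : R -> R) (t : nat -> R) m n : nondecreasing_seq t ->
  \sum_(i < m) f (t i) * (dcdf n (t i.+1) - dcdf n (t i)) =
  \sum_(e <- l n) e.1 * step_fun f t m e.2.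
Proof.
move=> tnd; under [RHS]eq_bigr do rewrite /step_fun mulr_sumr.
rewrite exchange_big/=; apply: eq_bigr => i _.
rewrite [X in X - _](bigID (fun e : R * R => e.2 <= t i))/=.
have -> : \sum_(e <- l n | (e.2 <= t i.+1) && (e.2 <= t i)) e.1 = dcdf n (t i).
  apply: eq_bigl => e; case: (leP e.2 (t i)) => h; rewrite ?andbF// andbT.
  by rewrite (le_trans h)// tnd.
rewrite addrAC subrr add0r mulr_sumr big_mkcond/=; apply: eq_bigr => e _.
rewrite indicE; case: ifPn => [/andP[h1 h2]|h].
  by rewrite mem_set ?mulr1 1?mulrC//= in_itv/= h1 ltNge h2.
rewrite memNset ?mulr0//= in_itv/= => /andP[h1 h2]; move/negP: h; apply.
by rewrite h2 -ltNge.
Qed.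

Lemma dcdf_step_close (f : R -> R) (t : nat -> R) m n (h lam B : R) :
  nondecreasing_seq t -> 0 <= lam ->
  (forall i, t i.+1 - t i <= h) -> (forall y, `|f y| <= B) ->
  (forall y z, `|f y - f z| <= lam * `|y - z|) ->
  `|\sum_(e <- l n) e.1 * f e.2 - \sum_(i < m) f (t i) * (dcdf n (t i.+1) - dcdf n (t i))|
   <= lam * h + B * (1 - (dcdf n (t m) - dcdf n (t 0%N))).
Proof.
move=> tnd lam0 th fB fl; rewrite dcdf_step// -sumrB.
rewrite (le_trans (ler_norm_sum _ _ _))//.
apply: (@le_trans _ _ (\sum_(e <- l n) e.1 * (lam * h + B * (1 - \1_(`]t 0%N, t m]%classic) e.2)))).
  rewrite big_seq [leRHS]big_seq ler_sum// => e en.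
  rewrite -mulrBr normrM gtr0_norm ?(l_gt0 en)// ler_pM2l ?(l_gt0 en)//.
  exact: step_fun_close.
have -> : dcdf n (t m) - dcdf n (t 0%N) = \sum_(e <- l n) e.1 * \1_(`]t 0%N, t m]%classic) e.2.
  rewrite /dcdf [X in X - _](bigID (fun e : R * R => e.2 <= t 0%N))/=.
  rewrite (eq_bigl (fun e : R * R => e.2 <= t 0%N)); last first.
    move=> e; case: (leP e.2 (t 0%N)) => k; rewrite ?andbF// andbT.
    by rewrite (le_trans k)// tnd.
  rewrite addrAC subrr add0r big_mkcond/=; apply: eq_bigr => e _.
  rewrite indicE; case: ifPn => [/andP[h1 h2]|k].
    by rewrite mem_set ?mulr1//= in_itv/= h1 ltNge h2.
  rewrite memNset ?mulr0//= in_itv/= => /andP[h1 h2]; move/negP: k; apply.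
  by rewrite h2 -ltNge.
under eq_bigr do rewrite mulrDr [_ * (B * _)]mulrCA mulrBr mulr1.
by rewrite big_split/= -mulr_suml l_sum mul1r -mulr_sumr sumrB l_sum.
Qed.

Lemma summation_by_parts (f D : nat -> R) m :
  \sum_(i < m) f i * (D i.+1 - D i) =
  f m * D m - f 0%N * D 0%N - \sum_(i < m) (f i.+1 - f i) * D i.+1.
Proof. by elim: m => [|m IH]; rewrite ?big_ord0 ?subrr// !big_ord_recr/= IH; ring. Qed.

(** At a grid point the two functions differ by at most the increment of ucdf
    over the next cell. After a summation by parts these increments are
    multiplied by increments of f, at most lam * h, and they add up to at
    most 1. *)
Lemma ucdf_rcdf_step (f : R -> R) (t : nat -> R) m (h lam B : R) :
  (forall i, t i < t i.+1) -> 0 <= lam ->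
  (forall i, t i.+1 - t i <= h) -> (forall y, `|f y| <= B) ->
  (forall y z, `|f y - f z| <= lam * `|y - z|) ->
  `|\sum_(i < m) f (t i) * (rcdf (t i.+1) - rcdf (t i)) -
    \sum_(i < m) f (t i) * (ucdf (t i.+1) - ucdf (t i))|
  <= lam * h + B * ((1 - ucdf (t m)) + rcdf (t 0%N)).
Proof.
move=> tlt lam0 th fB fl; rewrite -sumrB.
pose D i := rcdf (t i) - ucdf (t i).
have D0 i : 0 <= D i by rewrite subr_ge0 ucdf_le_rcdf.
under eq_bigr => i _.
  rewrite (_ : _ - _ = f (t i) * (D i.+1 - D i)); last by rewrite /D; ring.
  over.
rewrite (summation_by_parts (f \o t))/=.
have hlam : 0 <= lam * h by rewrite mulr_ge0// (le_trans _ (th 0%N))// subr_ge0 ltW.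
have S1 : `|\sum_(i < m) (f (t i.+1) - f (t i)) * D i.+1| <= lam * h.
  rewrite (le_trans (ler_norm_sum _ _ _))//.
  apply: (@le_trans _ _ (\sum_(i < m) lam * h * (ucdf (t i.+2) - ucdf (t i.+1)))).
    apply: ler_sum => i _; rewrite normrM ler_pM//.
      rewrite (le_trans (fl _ _))// ler_wpM2l// ger0_norm// subr_ge0.
      exact: ltW.
    by rewrite ger0_norm// lerD2r rcdf_le.
  rewrite -mulr_sumr ler_piMr//.
  rewrite -(big_mkord xpredT (fun i => ucdf (t i.+2) - ucdf (t i.+1))).
  by rewrite (telescope_sumr (fun i => ucdf (t i.+1)))// lerBlDr (le_trans (ucdf_le1 _))// lerDl ucdf_ge0.
have S2 : `|f (t m) * D m| <= B * (1 - ucdf (t m)).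
  by rewrite normrM ler_pM// ger0_norm// lerD2r rcdf_le1.
have S3 : `|f (t 0%N) * D 0%N| <= B * rcdf (t 0%N).
  by rewrite normrM ler_pM// ger0_norm// gerBl ucdf_ge0.
rewrite (le_trans (ler_normB _ _))// [leLHS]addrC lerD// [leRHS]mulrDr.
by rewrite (le_trans (ler_normB _ _))// lerD.
Qed.

(** Both sides are compared with Riemann sums on a grid of ]-A, A]: the sums
    of the approximating measures converge because they involve finitely many
    values of the cumulative functions, and uniform tightness makes the
    mass outside ]-A, A] small. *)
Theorem helly_selection : exists P : probability (measurableTypeR R) R,
  forall (f : R -> R) (B lam : R), 0 <= lam -> (forall y, `|f y| <= B) ->
    (forall y z, `|f y - f z| <= lam * `|y - z|) ->
    \sum_(e <- l n) e.1 * f e.2 @[n --> U] --> \int[P]_x f x.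
Proof.
have [P PE] := probability_of_cdf rcdf_nd rcdf_rc rcdf_cvgNy rcdf_cvgy.
exists P => f B lam lam0 fB fl; apply/cvgrPdistC_le => e e0.
have B0 : 0 <= B by rewrite (le_trans _ (fB 0)).
(* all but a small part of every mass lies in ]-A, A] *)
have [A A0 BA] : exists2 A, 0 < A & B * (16 * K / A ^+ 2) <= e / 3.
  have [|A A0 h] := @tail_small (e / 3 / 4 / (B + 1)).
    by rewrite !divr_gt0// ltr_wpDl.
  exists A => //; rewrite (_ : 16 * K / A ^+ 2 = 4 * (4 * K / A ^+ 2)); last by ring.
  apply: (@le_trans _ _ (B * (4 * (e / 3 / 4 / (B + 1))))).
    by rewrite ler_wpM2l// ler_wpM2l.
  have B1 : 0 < B + 1 by rewrite ltr_wpDl.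
  rewrite (_ : B * _ = e / 3 * (B / (B + 1))); last by field; rewrite gt_eqF.
  by rewrite ler_piMr ?divr_ge0 ?ltW// ltr_pdivrMr// mul1r ltrDl.
pose m := (Num.truncn (`|18 * lam * A / e|)).+1.
have m0 : 0 < m%:R :> R by rewrite ltr0n.
pose h := 2 * A / m%:R.
have h0 : 0 < h by rewrite divr_gt0// mulr_gt0.
have lamh : 3 * (lam * h) <= e / 3.
  have : 18 * lam * A / e <= m%:R.
    by rewrite (le_trans (ler_norm _))// ltW// truncnS_gt.
  rewrite ler_pdivrMr// /h => hm; rewrite !mulrA ler_pdivrMr//; lra.
pose t (i : nat) : R := - A + i%:R * h.
have tlt i : t i < t i.+1 by rewrite /t ltrD2l ltr_pM2r// ltr_nat.
have tnd : nondecreasing_seq t by apply/nondecreasing_seqP => i; exact: ltW.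
have th i : t i.+1 - t i <= h by rewrite /t -[i.+1]addn1 natrD; lra.
have t0 : t 0%N = - A by rewrite /t mul0r addr0.
have tm : t m = A by rewrite /t /h; field; rewrite gt_eqF.
pose S := \sum_(i < m) f (t i) * (ucdf (t i.+1) - ucdf (t i)).
have SE : \sum_(i < m) f (t i) * (dcdf n (t i.+1) - dcdf n (t i)) @[n --> U] --> S.
  apply: cvg_ord_sum => i; apply: cvgM; first exact: cvg_cst.
  by apply: cvgB; exact: ucdf_cvg.
have /cvgrPdistC_le/(_ (e / 3)) := SE.
rewrite divr_gt0// => /(_ isT); apply: filterS => n hn.
have h1 := dcdf_step_close m n tnd lam0 th fB fl.
have h2 := ucdf_rcdf_step m tlt lam0 th fB fl.
have h3 := Rintegral_step_close P m tnd lam0 th fB fl.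
have pE a b : a <= b -> fine (P `]a, b]%classic) = rcdf b - rcdf a.
  by move=> ab; rewrite PE.
rewrite pE in h3; last exact: tnd.
have PS : \sum_(i < m) f (t i) * fine (P `]t i, t i.+1]%classic) =
    \sum_(i < m) f (t i) * (rcdf (t i.+1) - rcdf (t i)).
  by apply: eq_bigr => i _; rewrite pE// ltW.
rewrite PS in h3.
have BK : B * (1 - (dcdf n (t m) - dcdf n (t 0%N))) + B * ((1 - ucdf (t m)) + rcdf (t 0%N))
   + B * (1 - (rcdf (t m) - rcdf (t 0%N))) <= e / 3.
  apply: le_trans BA; rewrite -!mulrDr ler_wpM2l// t0 tm.
  have k1 := dcdf_left n A0; have k2 := dcdf_right n A0.
  have k3 := ucdf_right A0; have k4 := rcdf_left A0; have k5 := rcdf_right A0.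
  have -> : 16 * K / A ^+ 2 = 16 * (K / A ^+ 2) by ring.
  have k4' : rcdf (- A) <= 4 * (K / A ^+ 2) by rewrite mulrA.
  have k6 : 0 <= K / A ^+ 2 by rewrite divr_ge0 ?K_ge0// exprn_ge0// ltW.
  lra.
move: h1 h2 h3 hn; rewrite -/S.
set s1 := (\sum_(i < m) _ * _); set s2 := (\sum_(i < m) _ * (rcdf _ - _)).
set I := Rintegral _ _ _; set E := (\sum_(_ <- _) _).
rewrite !ler_norml => /andP[a1 a2] /andP[b1 b2] /andP[c1 c2] /andP[d1 d2].
by apply/andP; split; lra.
Qed.

End helly.

(** * Integrals against a purely atomic measure *)

Section atomic_measures.
Context {R : realType}.
Variables (w : nat -> {nonneg R}) (x : nat -> R).

Definition atomic_measure : {measure set (measurableTypeR R) -> \bar R} :=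
  mseries (fun k => mscale (w k) (\d_(x k : measurableTypeR R))) 0.

Definition atomic_sum (f : R -> R) n := \sum_(k < n) (w k)%:num * f (x k).

Lemma atomic_sum_cvg (f : R -> R) (B : R) : (forall k, 0 <= f (x k)) ->
  (forall n, atomic_sum f n <= B) -> cvgn (atomic_sum f).
Proof.
move=> f0 fB; apply: nondecreasing_is_cvgn; last by exists B => _ [n _ <-].
by apply/nondecreasing_seqP => n; rewrite /atomic_sum big_ord_recr/= lerDl mulr_ge0.
Qed.

Lemma atomic_integral_ge0 (f : R -> R) (B : R) : measurable_fun [set: measurableTypeR R] f ->
  (forall t, 0 <= f t) -> (forall n, atomic_sum f n <= B) ->
  (\int[atomic_measure]_t (f t)%:E = (limn (atomic_sum f))%:E)%E.
Proof.
move=> mf f0 fB; have mE : measurable_fun [set: measurableTypeR R] (EFin \o f) by exact/measurable_EFinP.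
rewrite ge0_integral_measure_series//; last by move=> t _; rewrite lee_fin.
have fc := atomic_sum_cvg (fun k => f0 (x k)) fB.
rewrite -EFin_lim//; congr (lim (_ @ \oo)%classic); apply/funext => n /=.
rewrite /atomic_sum -sumEFin big_mkord; apply: eq_bigr => k _.
rewrite ge0_integral_mscale//; last by move=> t _; rewrite lee_fin.
by rewrite integral_dirac// diracT mul1e.
Qed.

Lemma atomic_measure_pos k (A : set (measurableTypeR R)) : measurable A ->
  A (x k) -> (((w k)%:num)%:E <= atomic_measure A)%E.
Proof.
move=> mA Ak; rewrite /atomic_measure/= /mseries.
rewrite ereal_series (@nneseries_split _ _ 0 k.+1)//= add0n big_mkord big_ord_recr/=.
rewrite /mscale/= diracE mem_set// mule1 -addeA addeCA leeDl// adde_ge0//.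
  by apply: sume_ge0 => i _; exact: mule_ge0.
by apply: nneseries_ge0 => i _ _; exact: mule_ge0.
Qed.

Lemma atomic_measure0 (A : set (measurableTypeR R)) : (forall k, ~ A (x k)) ->
  atomic_measure A = 0%E.
Proof.
move=> nA; rewrite /atomic_measure/= /mseries eseries0// => k _ _.
change (((w k)%:num%:E * \d_(x k : measurableTypeR R) A)%E = 0%E).
by rewrite diracE memNset// mule0.
Qed.

Variable S : R.
Hypothesis w_sum : forall n, \sum_(k < n) (w k)%:num <= S.

Lemma atomic_Rintegral (f : R -> R) (B : R) (s : {nonneg R}) :
  measurable_fun [set: measurableTypeR R] f -> (forall t, `|f t| <= B) ->
  atomic_sum f @ \oo --> \int[atomic_measure]_t f t /\
  \int[mscale s atomic_measure]_t f t = s%:num * \int[atomic_measure]_t f t.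
Proof.
move=> mf fB.
have B0 : 0 <= B by rewrite (le_trans _ (fB 0)).
have bnd (g : R -> R) : (forall t, g t <= B) -> forall n, atomic_sum g n <= S * B.
  move=> gB n; rewrite /atomic_sum (@le_trans _ _ (\sum_(k < n) (w k)%:num * B))//.
    by apply: ler_sum => k _; rewrite ler_wpM2l.
  by rewrite -mulr_suml ler_wpM2r.
pose fp t := Num.max (f t) 0; pose fn t := Num.max (- f t) 0.
have fp0 t : 0 <= fp t by rewrite le_max lexx orbT.
have fn0 t : 0 <= fn t by rewrite le_max lexx orbT.
have fpB t : fp t <= B by rewrite ge_max B0 andbT (le_trans (ler_norm _)).
have fnB t : fn t <= B by rewrite ge_max B0 andbT (le_trans (ler_norm _))// normrN.
have mfp : measurable_fun [set: measurableTypeR R] fp by exact: measurable_funrpos.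
have mfn : measurable_fun [set: measurableTypeR R] fn by exact: measurable_funrneg.
have Ep : ((EFin \o f)^\+ = EFin \o fp)%E by apply/funext => t; rewrite funeposE /= EFin_max.
have En : ((EFin \o f)^\- = EFin \o fn)%E by apply/funext => t; rewrite funenegE /= EFin_max.
have ip := atomic_integral_ge0 mfp fp0 (bnd _ fpB).
have in_ := atomic_integral_ge0 mfn fn0 (bnd _ fnB).
have E1 : \int[atomic_measure]_t f t = limn (atomic_sum fp) - limn (atomic_sum fn).
  by rewrite /Rintegral integralE Ep En /= ip in_.
split.
  rewrite E1 (_ : atomic_sum f = (fun n => atomic_sum fp n - atomic_sum fn n)).
    by apply: cvgB; [exact: atomic_sum_cvg (bnd _ fpB)|exact: atomic_sum_cvg (bnd _ fnB)].
  apply/funext => n; rewrite /atomic_sum -sumrB; apply: eq_bigr => k _.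
  rewrite -mulrBr; congr (_ * _); rewrite /fp /fn.
  have [h|] := boolP (0 <= f (x k)).
    by rewrite (max_l h) max_r ?subr0// oppr_le0.
  rewrite -ltNge => /ltW h; rewrite (max_r h) max_l ?sub0r ?opprK// oppr_ge0//.
rewrite E1 /Rintegral integralE Ep En ge0_integral_mscale//; last 2 first.
- exact/measurable_EFinP.
- by move=> t _; rewrite lee_fin.
rewrite ge0_integral_mscale//; last 2 first.
- exact/measurable_EFinP.
- by move=> t _; rewrite lee_fin.
by rewrite /= ip in_ -!EFinM/= mulrBr.
Qed.

End atomic_measures.

(** * The Levy measure and its Pick function *)

Section parameters.
Context {R : realType}.

Definition jump (k : nat) : R := 2 ^+ k.+1.
Definition weight (k : nat) : R := (k`!%:R)^-1.
(** The modulus changes nothing to the value, by levy_weightE; it provides the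
    proof of nonnegativity that the type requires. *)
Definition levy_weight (k : nat) : {nonneg R} := (`|weight k / jump k ^+ 2|)%:nng.
Definition levy : {measure set (measurableTypeR R) -> \bar R} := atomic_measure levy_weight jump.

Lemma jump_gt0 k : 0 < jump k. Proof. by rewrite exprn_gt0. Qed.

Lemma weight_gt0 k : 0 < weight k. Proof. by rewrite invr_gt0 ltr0n fact_gt0. Qed.

Lemma levy_weightE k : (levy_weight k)%:num = weight k / jump k ^+ 2.
Proof. by rewrite /= ger0_norm// divr_ge0 ?sqr_ge0// ltW// weight_gt0. Qed.

Lemma jump_ge2 k : 2 <= jump k.
Proof. by rewrite /jump exprS ler_peMr// exprn_ege1// ler1n. Qed.

(** The sum over k of weight k * jump k ^+ j, that is, of 2^j (2^j)^k / k!. *)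
Definition moment_bound j : R := 2 ^+ j * expR (2 ^+ j).

Lemma sum_weight_jump j n : \sum_(k < n) weight k * jump k ^+ j <= moment_bound j.
Proof.
have E : \sum_(k < n) weight k * jump k ^+ j = 2 ^+ j * series (exp_coeff (2 ^+ j)) n.
  rewrite /series/= big_mkord mulr_sumr; apply: eq_bigr => k _.
  rewrite /exp_coeff/= /weight /jump -exprM mulSn exprD [(k * j)%N]mulnC exprM.
  by rewrite mulrC -mulrA.
rewrite E ler_wpM2l ?exprn_ge0//.
apply: nondecreasing_cvgn_le; last exact: is_cvg_series_exp_coeff.
by apply: nondecreasing_series => k _ _; exact: exp_coeff_ge0.
Qed.

Lemma sum_weight n : \sum_(k < n) weight k <= expR 1.
Proof.
have := sum_weight_jump 0 n; rewrite /moment_bound expr0 mul1r => /(le_trans _); apply.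
by apply: ler_sum => k _; rewrite expr0 mulr1.
Qed.

Lemma sum_levy_weight n : \sum_(k < n) (levy_weight k)%:num <= expR 1.
Proof.
apply: le_trans (sum_weight n); apply: ler_sum => k _; rewrite levy_weightE.
by rewrite ler_piMr ?(ltW (weight_gt0 k))// invf_le1 ?exprn_gt0 ?jump_gt0// exprn_ege1//
  (le_trans _ (jump_ge2 k))// ler1n.
Qed.

Definition phi (w : R[i]) : R[i] :=
  xget 0 [set v | cvgC \oo (fun n => pick_sum weight jump n w) v].

(** The terms of the series are at most weight k / Im w in modulus. *)
Lemma phi_lim w : 0 < Im w -> cvgC \oo (fun n => pick_sum weight jump n w) (phi w).
Proof.
move=> w0.
have [] : exists v, cvgC \oo (fun n => pick_sum weight jump n w) v; last first.
  by move=> v hv; exact: (xgetI 0 hv).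
apply: (@bounded_variation_cvgC _ _ (expR 1 / Im w)) => n.
apply: (@le_trans _ _ (\sum_(k < n) weight k / Im w)); last first.
  by rewrite -mulr_suml ler_pM2r ?invr_gt0 ?sum_weight.
apply: ler_sum => k _; rewrite /pick_sum big_ord_recr/= addrAC subrr add0r normcM.
by rewrite normc_real gtr0_norm ?weight_gt0// ler_pM2l ?weight_gt0// normc_inv_le.
Qed.

Variable s : R.
Hypothesis s_gt0 : 0 < s.
Let c k := s * weight k.
Let S := s * expR 1.

Lemma c_gt0 k : 0 < c k. Proof. by rewrite mulr_gt0 ?weight_gt0. Qed.

Lemma c_sum n : \sum_(k < n) c k <= S.
Proof. by rewrite -mulr_sumr ler_pM2l ?sum_weight. Qed.

Lemma sphi_lim w : 0 < Im w -> cvgC \oo (fun n => pick_sum c jump n w) (s%:C * phi w).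
Proof.
move=> /phi_lim/(@cvgCZ _ _ _ _ s%:C _); rewrite (_ : (fun n => _ * _) = (fun n => pick_sum c jump n w))//.
apply/funext => n; rewrite /pick_sum mulr_sumr; apply: eq_bigr => k _.
by rewrite mulrA -rmorphM.
Qed.

Let l := approx_mass c jump.

Let l_gt0 n e : e \in l n -> 0 < e.1. Proof. exact: (approx_mass_gt0 c_gt0). Qed.
Let l_sum n : \sum_(e <- l n) e.1 = 1. Proof. exact: (approx_mass_sum _ c_gt0). Qed.

Let sum_bound_ge0 : 0 <= S. Proof. by rewrite mulr_ge0 ?expR_ge0// ltW. Qed.

(** With z = iy, the sum over the atoms q of mass * q^2 / (q^2 + y^2) is the
    real part of 1 - z / F_n z, which is at most S / y^2, and the factor
    q^2 / (q^2 + y^2) is at least 1/2 when |q| >= y. *)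
Lemma approx_tight n y : 0 < y -> \sum_(e <- l n | y <= `|e.2|) e.1 <= 2 * S / y ^+ 2.
Proof.
move=> y0; pose z : R[i] := 0 +i* y; pose F := iterF c jump n z.
have yF : y <= Im F by exact: (@iterF_Im _ _ jump c_gt0 n z y0).
have F0 : F != 0 by rewrite Im_gt0_neq0// (lt_le_trans y0).
have Fz : normc (F - z) <= S / y.
  rewrite /F; case: n {F yF F0} => [|n].
    by rewrite /iterF /cauchy_sum big_nil subr0 subrr normc0 divr_ge0// ltW.
  rewrite (iterFS_Im jump c_gt0)// addrAC subrr add0r normc_opp.
  by apply: (pick_sum_le _ c_gt0 c_sum) => //; exact: (@iterF_Im _ _ jump c_gt0 n z y0).
have E : \sum_(e <- l n) e.1 * (e.2 ^+ 2 / (e.2 ^+ 2 + y ^+ 2)) = Re ((F - z) / F).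
  rewrite mulrBl divff// ReD ReN -(approx_massE _ c_gt0 n) //.
  rewrite /cauchy_sum mulr_sumr Re_sum -[Re 1](l_sum n) -sumrB.
  apply: eq_bigr => e _; rewrite [z * _]mulrCA ReZ -[X in X - _]mulr1 -mulrBr; congr (_ * _).
  have h : e.2 ^+ 2 + y ^+ 2 != 0 by rewrite gt_eqF// ltr_wpDl ?sqr_ge0// exprn_gt0.
  by rewrite /= sub0r subr0 sqrrN; field.
have bnd : Re ((F - z) / F) <= S / y ^+ 2.
  rewrite (le_trans (ler_norm _))// (le_trans (normRe_le _))// normcM normcV expr2 invfM mulrA.
  rewrite ler_pM ?normc_ge0 ?invr_ge0 ?normc_ge0// lef_pV2 ?posrE ?normc_gt0//.
  by rewrite (le_trans yF)// Im_le_normc.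
apply: (@le_trans _ _ (2 * Re ((F - z) / F))); last by rewrite -mulrA ler_pM2l.
rewrite -E mulr_sumr big_mkcond/= big_seq [leRHS]big_seq; apply: ler_sum => e el.
have y2 : 0 < y ^+ 2 by rewrite exprn_gt0.
have d0 : 0 < e.2 ^+ 2 + y ^+ 2 by rewrite ltr_wpDl ?sqr_ge0.
have el0 := l_gt0 el.
case: ifPn => [ye|_]; last by rewrite mulr_ge0// mulr_ge0 ?divr_ge0 ?sqr_ge0// ltW.
rewrite mulrCA ler_peMr ?(ltW el0)// mulrA ler_pdivlMr// mul1r.
have : y ^+ 2 <= e.2 ^+ 2 by rewrite -[X in _ <= X]real_normK ?num_real// lerXn2r ?nnegrE// ltW.
by move=> h; rewrite mulr_natl mulr2n lerD2l.
Qed.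

End parameters.

(** * Existence and gaps of the free convolution powers *)

Section laws.
Context {R : realType}.

(** The law of the free convolution power of exponent s, described by the
    functional equation of its reciprocal Cauchy transform far from the real
    axis. For s = 0 it describes the Dirac mass at 0. *)
Definition free_law (s : R) (mu : probability (measurableTypeR R) R) :=
  exists2 H, 0 < H & forall z, H < Im z -> Im z <= Im (F_transform mu z) /\
    F_transform mu z + s%:C * phi (F_transform mu z) = z.

Lemma resolvent_bound (z : R[i]) (t : R) : 0 < Im z -> normc (1 / (z - t%:C)) <= (Im z)^-1.
Proof. by move=> z0; rewrite div1r normc_inv_le. Qed.

Lemma resolvent_lip (z : R[i]) (t u : R) : 0 < Im z ->
  normc (1 / (z - t%:C) - 1 / (z - u%:C)) <= (Im z)^-1 ^+ 2 * `|t - u|.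
Proof.
move=> z0; have nt v : z - v%:C != 0 by rewrite subr_eq0 Im_gt0_neq_real.
have -> : 1 / (z - t%:C) - 1 / (z - u%:C) =
  (z - t%:C)^-1 * (z - u%:C)^-1 * (t - u)%:C by rewrite rmorphB/=; field; rewrite !nt.
rewrite 2!normcM normc_real ler_wpM2r// expr2 ler_pM ?normc_ge0// normc_inv_le//.
Qed.

Variable s : R.
Hypothesis s_gt0 : 0 < s.
Let c k := s * @weight R k.
Let S := s * expR 1.
Let l := approx_mass c jump.

Let c0 : forall k, 0 < c k. Proof. exact: c_gt0. Qed.

(** The real and imaginary parts of 1 / (z - x) are bounded and Lipschitz in x,
    so the Cauchy transforms of the approximating measures converge to the one
    of the weak limit. The last clause transfers to the limit that the
    approximating measures have no atom in some region. *)
Lemma law_exists : exists mu : probability (measurableTypeR R) R,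
  free_law s mu /\ forall (f : R -> R) (B lam : R), 0 <= lam -> (forall y, `|f y| <= B) ->
    (forall y z, `|f y - f z| <= lam * `|y - z|) ->
    (forall n e, e \in l n -> f e.2 = 0) -> \int[mu]_x f x = 0.
Proof.
have [U [UU Uoo]] := exists_ultrafilter.
have [mu muP] := helly_selection (fun n e => @approx_mass_gt0 _ _ _ c0 n e)
  (approx_mass_sum jump c0) (approx_tight s_gt0) UU.
have S0 : 0 <= S by rewrite mulr_ge0 ?expR_ge0// ltW.
exists mu; split; last first.
  move=> f B lam lam0 fB fl f0; have := muP f B lam lam0 fB fl.
  rewrite (_ : (fun n => _) = cst 0); last first.
    by apply/funext => n; rewrite big_seq big1// => e /f0 ->; rewrite mulr0.
  by move=> h; apply: (cvg_unique _ h (cvg_cst (0 : R))).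
exists (1 + 2 * S) => [|z zH]; first by rewrite ltr_wpDr// mulr_ge0.
have z1 : 1 <= Im z by rewrite (le_trans _ (ltW zH))// lerDl mulr_ge0.
have z0 : 0 < Im z by apply: lt_le_trans z1.
have zS : 2 * S <= Im z ^+ 2.
  by rewrite (@le_trans _ _ (Im z))// ?expr2 ?ler_peMr// ?ltW// (le_lt_trans _ zH)// lerDr.
have [w [Fw zw wz]] := iterF_cvg c0 (c_sum s_gt0) (@sphi_lim _ s) z1 zS.
have w0 : 0 < Im w by apply: lt_le_trans zw.
have wn0 : w != 0 by rewrite Im_gt0_neq0.
suff Gw : cauchy_transform mu z = w^-1 by rewrite /F_transform Gw div1r invrK.
have lim1 : cvgC U (fun n => cauchy_sum (l n) z) (cauchy_transform mu z).
  apply: cvgC_ReIm.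
    rewrite (_ : (fun n => _) = (fun n => \sum_(e <- l n) e.1 * Re (1 / (z - e.2%:C)))); last first.
      by apply/funext => n; rewrite Re_sum; apply: eq_bigr => e _; rewrite ReZ div1r.
    apply: (muP _ (Im z)^-1 ((Im z)^-1 ^+ 2)); first by rewrite exprn_ge0// invr_ge0 ltW.
      by move=> y; rewrite (le_trans (normRe_le _))// resolvent_bound.
    by move=> y u; rewrite -ReN -ReD (le_trans (normRe_le _))// resolvent_lip.
  rewrite (_ : (fun n => _) = (fun n => \sum_(e <- l n) e.1 * Im (1 / (z - e.2%:C)))); last first.
    by apply/funext => n; rewrite Im_sum; apply: eq_bigr => e _; rewrite ImZ div1r.
  apply: (muP _ (Im z)^-1 ((Im z)^-1 ^+ 2)); first by rewrite exprn_ge0// invr_ge0 ltW.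
    by move=> y; rewrite (le_trans (normIm_le _))// resolvent_bound.
  by move=> y u; rewrite -ImN -ImD (le_trans (normIm_le _))// resolvent_lip.
apply: (cvgC_unique _ lim1).
have UF : Filter U by typeclasses eauto.
have FwU : cvgC U (fun n => iterF c jump n z) w.
  by move=> A /Fw; exact: Uoo.
apply: (@cvgC_squeeze _ _ _ _ (fun n => (Im z)^-1 ^+ 2 * normc (iterF c jump n z - w))).
  apply: nearW => n; rewrite (approx_massE jump c0)//.
  have Fz : Im z <= Im (iterF c jump n z) by exact: iterF_Im.
  have F0 : iterF c jump n z != 0 by rewrite Im_gt0_neq0// (lt_le_trans z0).
  have -> : (iterF c jump n z)^-1 - w^-1 = (iterF c jump n z)^-1 * w^-1 * (w - iterF c jump n z).
    by field; rewrite F0 wn0.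
  rewrite 2!normcM [normc (w - _)]normcB ler_wpM2r ?normc_ge0// expr2.
  rewrite ler_pM ?normc_ge0//; rewrite -[X in normc X^-1]subr0; exact: (normc_inv_le 0).
by rewrite -[X in _ --> X](mulr0 ((Im z)^-1 ^+ 2)); apply: cvgM => //; exact: cvg_cst.
Qed.

(** The region of the real line in which no approximating measure has an
    atom. *)
Definition off_jumps (t : R) := 1 < `|t| /\ forall k, S + 2 <= `|t - jump k|.

Lemma integral_eq0_null (mu : probability (measurableTypeR R) R) (f : R -> R) (A : set (measurableTypeR R)) :
  measurable_fun [set: measurableTypeR R] f -> (forall t, 0 <= f t) ->
  mu.-integrable setT (EFin \o f) -> \int[mu]_x f x = 0 -> measurable A ->
  (forall t, A t -> f t != 0) -> mu A = 0%E.
Proof.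
move=> mf f0 fi f_eq0 mA Af.
have mE : measurable_fun [set: measurableTypeR R] (EFin \o f) by exact/measurable_EFinP.
have h : (\int[mu]_x `|(f x)%:E| = 0)%E.
  transitivity (\int[mu]_x (f x)%:E)%E.
    by apply: eq_integral => x _; rewrite gee0_abs// lee_fin.
  have /fineK <- : (\int[mu]_x (f x)%:E \is a fin_num)%E by exact: (integrable_fin_num measurableT fi).
  by congr EFin; exact: f_eq0.
have [N [mN N0 fN]] := (ae_eq_integral_abs mu measurableT mE).1 h.
apply: (@subset_measure0 _ _ _ mu A N) => // t At; apply: fN => /=.
by move=> /(_ I)/= [ft]; move: (Af _ At); rewrite ft eqxx.
Qed.

Definition bump (a b t : R) : R := Num.max 0 (Num.min (t - a) (b - t)).

Lemma bump_ge0 a b t : 0 <= bump a b t.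
Proof. by rewrite /bump le_max lexx. Qed.

Lemma bump_neq0 a b t : (bump a b t != 0) = (a < t < b).
Proof.
rewrite neq_lt ltNge bump_ge0/= lt_max ltxx/= lt_min !subr_gt0.
by rewrite andbC andbC.
Qed.

Lemma bump_le a b t : `|bump a b t| <= `|b - a|.
Proof.
rewrite ger0_norm ?bump_ge0// /bump ge_max normr_ge0/= ge_min.
have [h|h] := leP t b.
  by apply/orP; left; rewrite (le_trans _ (ler_norm _))// lerD2r.
apply/orP; right; rewrite (@le_trans _ _ 0)// subr_le0 ltW//.
Qed.

Lemma bump_lip a b t u : `|bump a b t - bump a b u| <= 1 * `|t - u|.
Proof.
rewrite mul1r /bump /Num.max /Num.min.
have h1 := ler_norm (t - u); have h2 : u - t <= `|t - u| by rewrite distrC ler_norm.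
rewrite ler_norml; move: `|t - u| h1 h2 => N h1 h2.
by case: (ltP (t - a) (b - t)) => ?; case: (ltP (u - a) (b - u)) => ?;
  repeat case: ltP => ?; apply/andP; split; lra.
Qed.

(** An interval of the forbidden region carries a Lipschitz bump function that
    vanishes at all the atoms of the approximating measures, hence has
    integral zero. *)
Lemma law_with_gaps : exists mu : probability (measurableTypeR R) R,
  free_law s mu /\ forall a b, (forall t, a < t < b -> off_jumps t) -> mu `]a, b[%classic = 0%E.
Proof.
have S0 : 0 <= S by rewrite mulr_ge0 ?expR_ge0// ltW.
have [mu [law int0]] := law_exists; exists mu; split => // a b ab.
have ml := lipschitz_measurable (bump_lip a b).
apply: (integral_eq0_null ml (bump_ge0 a b)).
- exact: bounded_integrable ml (bump_le a b).
- apply: int0 (bump_le a b) (bump_lip a b) _ => // n e en.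
  apply: contrapT => /eqP; rewrite bump_neq0 => /ab[t1 tk].
  have L1 : 1 < S + 2 by lra.
  have SL : S <= S + 2 - 1 by lra.
  by have /eqP := approx_mass_gap c0 (c_sum s_gt0) L1 SL tk t1 en.
- exact: measurable_itv.
- by move=> t /=; rewrite in_itv/= bump_neq0.
Qed.

End laws.

(** * Inversion of the reciprocal Cauchy transform *)

Section law_inverse.
Context {R : realType}.
Local Notation E1 := (expR 1 : R).

Lemma phi_lip1 (w1 w2 : R[i]) h : 0 < h -> h <= Im w1 -> h <= Im w2 ->
  normc (phi w1 - phi w2) <= E1 / h ^+ 2 * normc (w1 - w2).
Proof. exact: (phi_lip (@weight_gt0 R) (@sum_weight R) (@phi_lim R)). Qed.

Lemma phi_le1 (w : R[i]) h : 0 < h -> h <= Im w -> normc (phi w) <= E1 / h.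
Proof. exact: (phi_le (@weight_gt0 R) (@sum_weight R) (@phi_lim R)). Qed.

(** The difference quotient of 1 / (z - x) differs from -1 / (z - x)^2 by
    h / ((z + h - x) (z - x)^2); summing over the poles gives a bound that is
    uniform in the number of terms. *)
Lemma phi_derivative (z : R[i]) : 0 < Im z -> exists D : R[i],
  forall h, h != 0 -> normc h <= Im z / 2 ->
    normc (h^-1 * (phi (h + z) - phi z) - D) <= normc h * (E1 / (Im z / 2) ^+ 3).
Proof.
move=> z0; pose x k : R := jump k; pose d n : R[i] :=
  - \sum_(k < n) (weight k)%:C * ((z - (x k)%:C)^-1 ^+ 2).
have y2 : 0 < Im z / 2 by rewrite divr_gt0.
have [D dD] : exists D, cvgC \oo d D.
  apply: (@bounded_variation_cvgC _ _ (E1 / (Im z) ^+ 2)) => n.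
  apply: (@le_trans _ _ (\sum_(k < n) weight k / (Im z) ^+ 2)); last first.
    by rewrite -mulr_suml ler_pM2r ?invr_gt0 ?exprn_gt0 ?sum_weight.
  apply: ler_sum => k _; rewrite /d big_ord_recr/= opprD addrAC subrr add0r normc_opp.
  rewrite normcM normc_real gtr0_norm ?weight_gt0// ler_pM2l ?weight_gt0// normcX.
  by rewrite -exprVn lerXn2r ?nnegrE ?invr_ge0 ?normc_ge0 ?(ltW z0)// normc_inv_le.
exists D => h h0 hz.
have hIm : Im z / 2 <= Im (h + z).
  by rewrite ImD; have := normIm_le h; rewrite ler_norml => /andP[+ _]; lra.
have zIm : Im z / 2 <= Im z by lra.
have lim : cvgC \oo (fun n => h^-1 * (pick_sum weight jump n (h + z) - pick_sum weight jump n z) - d n)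
    (h^-1 * (phi (h + z) - phi z) - D).
  apply: cvgCD; last exact: cvgCN.
  apply: cvgCZ; apply: cvgCD; first exact: phi_lim (lt_le_trans y2 hIm).
  by apply: cvgCN; exact: phi_lim.
apply: (cvgC_normc_le _ lim); apply: nearW => n.
rewrite /pick_sum -sumrB mulr_sumr opprK -big_split/=.
rewrite (le_trans (normc_sum _ _))//.
apply: (@le_trans _ _ (\sum_(k < n) weight k * (normc h / (Im z / 2) ^+ 3))).
  apply: ler_sum => k _.
  have n1 : z - (x k)%:C != 0 by rewrite Im_gt0_neq0// ImBr.
  have n2 : h + z - (x k)%:C != 0 by rewrite Im_gt0_neq0// ImBr (lt_le_trans y2).
  have -> : h^-1 * ((weight k)%:C / (h + z - (jump k)%:C) - (weight k)%:C / (z - (jump k)%:C))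
     + (weight k)%:C * (z - (x k)%:C)^-1 ^+ 2 =
    (weight k)%:C * (h * ((h + z - (x k)%:C)^-1 * (z - (x k)%:C)^-1 ^+ 2)).
    by rewrite /x; field; rewrite n1 n2 h0.
  rewrite normcM normc_real gtr0_norm ?weight_gt0// ler_pM2l ?weight_gt0// normcM.
  rewrite ler_wpM2l ?normc_ge0// normcM normcX [X in _ <= X^-1]exprS invfM -[X in _ <= _ * X]exprVn.
  rewrite ler_pM ?exprn_ge0 ?normc_ge0 ?normc_inv_le//.
  by rewrite lerXn2r ?nnegrE ?invr_ge0 ?normc_ge0 ?(ltW y2)// normc_inv_le.
rewrite -mulr_suml mulrCA ler_wpM2l ?normc_ge0//.
by rewrite ler_pM2r ?invr_gt0 ?exprn_gt0 ?sum_weight.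
Qed.

Lemma phi_derivable (s : R) (z : R[i]) : 0 < Im z ->
  derivable ((fun w => w + s%:C * phi w) : R[i]^o -> R[i]^o) z 1.
Proof.
move=> z0.
have [D hD] := phi_derivative z0.
apply/cvg_ex; exists (1 + s%:C * D); apply/cvgrPdist_le => e e0.
have eR : e = (Re e)%:C by apply: eqC_ReIm => //=; move: e0; rewrite ltcE/= => /andP[/eqP ->].
have e1 : 0 < Re e by move: e0; rewrite eR ltcR.
pose B := (`|s| + 1) * (E1 / (Im z / 2) ^+ 3).
have B0 : 0 < B.
  by rewrite mulr_gt0 ?ltr_wpDl// divr_gt0 ?expR_gt0// exprn_gt0// divr_gt0.
(* the norm of complex numbers is complex-valued: e is a positive real *)
pose dl := Num.min (Im z / 2) (Re e / B).
have dl0 : 0 < dl by rewrite lt_min !divr_gt0.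
have normE (w : R[i]) : `|w| = (normc w)%:C by [].
near=> h.
have h0 : h != 0 by near: h; exact: nbhs_dnbhs_neq.
have hdl : normc h <= dl.
  by rewrite -lecR -normE; near: h; apply: dnbhs0_le; rewrite ltcR.
rewrite eR normE lecR normcB /=.
have -> : h^-1 *: ((h *: 1 + z + s%:C * phi (h *: 1 + z)) - (z + s%:C * phi z) : R[i]^o) - (1 + s%:C * D)
   = s%:C * (h^-1 * (phi (h + z) - phi z) - D).
  have sE (a : R[i]) (b : R[i]^o) : a *: b = (a * b : R[i]) by [].
  rewrite !sE mulr1; move: (phi (h + z)) (phi z) => p q.
  have alg (h' z' p' q' s' D' : R[i]) : h' != 0 ->
      h'^-1 * (h' + z' + s' * p' - (z' + s' * q')) - (1 + s' * D') =
      s' * (h'^-1 * (p' - q') - D') by move=> ?; field.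
  exact: alg.
rewrite normcM normc_real.
have hz : normc h <= Im z / 2 by rewrite (le_trans hdl)// ge_min lexx.
apply: (@le_trans _ _ (normc h * B)).
  rewrite /B mulrCA ler_pM ?normc_ge0//; first by rewrite lerDl.
  exact: hD.
by rewrite -ler_pdivlMr// (le_trans hdl)// ge_min lexx orbT.
Unshelve. all: by end_near. Qed.

(** Far from the real axis, w |-> w + s phi w is injective because s phi is a
    contraction there. As F maps z + s phi z to a solution w of
    w + s phi w = z + s phi z, it maps it to z. *)
Lemma law_F_inverse (s : R) (mu : probability (measurableTypeR R) R) :
  0 <= s -> free_law s mu ->
  exists2 M0, 0 < M0 & forall l M, M0 <= M -> F_inverse mu l M (fun z => z + s%:C * phi z).
Proof.
move=> s0 [H H0 law]; pose S := s * E1.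
have S0 : 0 <= S by rewrite mulr_ge0 ?expR_ge0.
exists (1 + H + 2 * S) => [|l M MM]; first by lra.
have gIm z : M < Im z -> M - S <= Im (z + s%:C * phi z).
  move=> zM; rewrite ImD lerD//; first exact: ltW.
  have z1 : 1 <= Im z by lra.
  have : normc (s%:C * phi z) <= S.
    rewrite normcM normc_real ger0_norm// ler_wpM2l//.
    by rewrite (le_trans (phi_le1 ltr01 z1))// divr1.
  by move=> /(le_trans (normIm_le _)); rewrite ler_norml => /andP[].
split.
- by move=> z [zM _]; have := gIm z zM; lra.
- move=> z [zM _]; have gz := gIm z zM.
  have [|] := law (z + s%:C * phi z); first by lra.
  set w := F_transform _ _ => wIm wz.
  have h0 : 0 < 1 + S by lra.
  have l1 : normc (phi z - phi w) <= E1 / (1 + S) ^+ 2 * normc (z - w) by apply: phi_lip1 => //; lra.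
  apply/eqP; rewrite -subr_eq0; apply: contraT => nz.
  have Ew : w - z = s%:C * (phi z - phi w).
    apply/subr0_eq; transitivity ((w + s%:C * phi w) - (z + s%:C * phi z)); first by ring.
    by rewrite wz subrr.
  have : normc (w - z) <= S / (1 + S) ^+ 2 * normc (w - z).
    rewrite {1}Ew normcM normc_real ger0_norm// (normcB w z) /S -!mulrA ler_wpM2l//.
    by rewrite mulrA.
  rewrite -{1}[normc (w - z)]mul1r ler_pM2r ?normc_gt0// ler_pdivlMr ?exprn_gt0//.
  by move=> k; exfalso; nra.
- by move=> z [zM _]; apply: phi_derivable; lra.
exists 1, H; split => // w [wH _] _.
by have [_ ->] := law w wH.
Qed.

End law_inverse.

(** * Free characteristic triplets and free infinite divisibility *)

Section triplets.
Context {R : realType}.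
Local Notation E1 := (expR 1 : R).

(** The Levy-Khintchine integral of the Levy measure is z phi(1/z) - drift z;
    this drift compensates the linear term. *)
Definition drift : R := - limn (fun n => \sum_(k < n) @weight R k / jump k).

Lemma drift_cvg : (fun n => \sum_(k < n) @weight R k / jump k) @ \oo --> - drift.
Proof.
rewrite opprK; apply: nondecreasing_is_cvgn.
  apply/nondecreasing_seqP => n; rewrite big_ord_recr/= lerDl divr_ge0//.
    exact: ltW (weight_gt0 _).
  exact: ltW (jump_gt0 _).
exists E1 => _ [n _ <-]; apply: le_trans (sum_weight n); apply: ler_sum => k _.
rewrite ler_piMr ?(ltW (weight_gt0 k))// invf_le1 ?jump_gt0//.
by rewrite (le_trans _ (jump_ge2 k))// ler1n.
Qed.

Definition lk_integrand (z : R[i]) (t : R) : R[i] :=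
  1 / (1 - t%:C * z) - 1 - t%:C * z * (\1_(`[-1, 1] : set R) t)%:C.

Lemma lk_resolvent (z : R[i]) (t : R) : Im z < 0 ->
  1 / (1 - t%:C * z) = z^-1 * (1 / (z^-1 - t%:C)).
Proof.
move=> z0; have zn : z != 0 by apply/eqP => zE; move: z0; rewrite zE /= ltxx.
have u0 : 0 < Im z^-1 by rewrite Im_inv divr_gt0 ?oppr_gt0// exprn_gt0// normc_gt0.
have nt : z^-1 - t%:C != 0 by rewrite subr_eq0 Im_gt0_neq_real.
by rewrite !div1r -invfM mulrBr divff// [z * _]mulrC.
Qed.

Lemma Im_inv_gt0 (z : R[i]) : Im z < 0 -> 0 < Im z^-1.
Proof.
move=> z0; have zn : z != 0 by apply/eqP => zE; move: z0; rewrite zE /= ltxx.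
by rewrite Im_inv divr_gt0 ?oppr_gt0// exprn_gt0// normc_gt0.
Qed.

Lemma small_indic (t : R) : `|t * \1_(`[-1, 1] : set R) t| <= 1.
Proof.
rewrite indicE; case: (boolP (t \in _)) => [|_]; last by rewrite mulr0 normr0.
by rewrite inE/= in_itv/= mulr1 => h; rewrite ler_norml.
Qed.

Lemma lk_bound (z : R[i]) (t : R) : Im z < 0 ->
  normc (lk_integrand z t) <= normc z^-1 / Im z^-1 + 1 + normc z.
Proof.
move=> z0; have u0 := Im_inv_gt0 z0.
rewrite /lk_integrand lk_resolvent// (le_trans (normcD_le _ _))// lerD//; last first.
  rewrite normc_opp mulrAC normcM -rmorphM normc_real -[leRHS]mul1r.
  by rewrite ler_wpM2r ?normc_ge0 ?small_indic.
rewrite (le_trans (normcD_le _ _))// lerD//; last by rewrite normc_opp normc1.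
by rewrite normcM ler_wpM2l ?normc_ge0// resolvent_bound.
Qed.

(** Here p is the real or the imaginary part. *)
Lemma lk_measurable (z : R[i]) (p : R[i] -> R) : Im z < 0 ->
  (forall v w, p (v + w) = p v + p w) -> (forall x v, p (x%:C * v) = x * p v) ->
  (forall v, `|p v| <= normc v) ->
  measurable_fun [set: measurableTypeR R] (fun t => p (lk_integrand z t)).
Proof.
move=> z0 pD pZ pn; have u0 := Im_inv_gt0 z0.
have pN v : p (- v) = - p v.
  by have -> : - v = (-1)%:C * v by [rewrite rmorphN rmorph1 mulN1r]; rewrite pZ mulN1r.
rewrite (_ : (fun t => _) = (fun t => p (z^-1 * (1 / (z^-1 - t%:C))) - p 1
   - t * \1_(`[-1, 1]) t * p z)); last first.
  apply/funext => t; rewrite /lk_integrand lk_resolvent// !pD !pN; congr (_ - _).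
  by rewrite mulrAC -rmorphM pZ.
apply: measurable_funB; last first.
  apply: measurable_funM; last exact: measurable_cst.
  apply: measurable_funM; first exact: measurable_id.
  by apply: measurable_indic; exact: measurable_itv.
apply: measurable_funB; last exact: measurable_cst.
apply: (@lipschitz_measurable _ _ (normc z^-1 * (Im z^-1)^-1 ^+ 2)) => t v.
rewrite -pN -pD -mulrBr (le_trans (pn _))// normcM -mulrA.
by rewrite ler_wpM2l ?normc_ge0// resolvent_lip.
Qed.

(** All jumps exceed 1, so the indicator in the integrand is zero at them, and
    what remains is a term of z phi(1/z) corrected by a multiple of z. *)
Lemma lk_jump (z : R[i]) k : Im z < 0 -> (levy_weight k)%:num%:C * lk_integrand z (jump k) =
  z * ((weight k)%:C / (z^-1 - (jump k)%:C)) + (weight k / jump k)%:C * z.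
Proof.
move=> z0; have zn : z != 0 by apply/eqP => zE; move: z0; rewrite zE /= ltxx.
have nt : z^-1 - (jump k)%:C != 0 by rewrite subr_eq0 Im_gt0_neq_real// Im_inv_gt0.
have j0 : (jump k)%:C != 0 :> R[i].
  by rewrite (_ : 0 = 0%:C)// (inj_eq (@complexI _)) gt_eqF ?jump_gt0.
rewrite /lk_integrand indicE memNset; last first.
  by rewrite /= in_itv/= => /andP[_]; rewrite leNgt (lt_le_trans _ (jump_ge2 k))// ltr1n.
rewrite mulr0 subr0 lk_resolvent// levy_weightE.
rewrite !fmorph_div rmorphXn/=.
have zz : z * z^-1 = 1 by rewrite divff.
move: (z^-1) zz nt => u zz nt.
have u0 : u != 0 by apply/eqP => u0; move: zz; rewrite u0 mulr0 => /eqP; rewrite eq_sym oner_eq0.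
have -> : z = u^-1 by rewrite -[RHS]mul1r -zz mulfK.
by field; rewrite nt j0 u0.
Qed.

(** The sums over the first n atoms converge to the integral by
    atomic_Rintegral, and to the right-hand side by lk_jump. *)
Lemma levy_khintchine_levy (z : R[i]) (s : {nonneg R}) : Im z < 0 ->
  Cintegral levy (lk_integrand z) = z * phi z^-1 - drift%:C * z /\
  Cintegral (mscale s levy) (lk_integrand z) = s%:num%:C * (z * phi z^-1 - drift%:C * z).
Proof.
move=> z0; pose B := normc z^-1 / Im z^-1 + 1 + normc z.
have mR := @lk_measurable z (@complex.Re R) z0 (@ReD R) (@ReZ R) (@normRe_le R).
have measurable_ocitv := @lk_measurable z (@complex.Im R) z0 (@ImD R) (@ImZ R) (@normIm_le R).
have bR t : `|Re (lk_integrand z t)| <= B by rewrite (le_trans (normRe_le _))// lk_bound.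
have bI t : `|Im (lk_integrand z t)| <= B by rewrite (le_trans (normIm_le _))// lk_bound.
have [cR sR] := atomic_Rintegral jump (@sum_levy_weight R) s mR bR.
have [cI sI] := atomic_Rintegral jump (@sum_levy_weight R) s measurable_ocitv bI.
have E : Cintegral levy (lk_integrand z) = z * phi z^-1 - drift%:C * z.
  pose u n : R[i] := \sum_(k < n) (levy_weight k)%:num%:C * lk_integrand z (jump k).
  have : cvgC \oo u (Cintegral levy (lk_integrand z)).
    apply: cvgC_ReIm.
      rewrite (_ : (fun n => _) = atomic_sum levy_weight jump (fun t => Re (lk_integrand z t))) //.
      by apply/funext => n; rewrite Re_sum; apply: eq_bigr => k _; rewrite ReZ.
    rewrite (_ : (fun n => _) = atomic_sum levy_weight jump (fun t => Im (lk_integrand z t))) //.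
    by apply/funext => n; rewrite Im_sum; apply: eq_bigr => k _; rewrite ImZ.
  move/cvgC_unique; apply.
  rewrite (_ : u = fun n => z * pick_sum weight jump n z^-1 +
      z * (\sum_(k < n) weight k / jump k)%:C); last first.
    apply/funext => n; rewrite rmorph_sum !mulr_sumr -big_split/=.
    by apply: eq_bigr => k _; rewrite lk_jump// [X in _ + X]mulrC.
  apply: cvgCD.
    by apply: cvgCZ; apply: phi_lim; exact: Im_inv_gt0.
  rewrite -mulNr mulrC -rmorphN; apply: cvgCZ; apply: cvgC_ReIm => /=.
    exact: drift_cvg.
  exact: cvg_cst.
split => //; rewrite -E /Cintegral sR sI.
by apply: eqC_ReIm => /=; rewrite ?mul0r ?subr0 ?addr0.
Qed.

Lemma levy_khintchine1 (z : R[i]) : Im z < 0 -> levy_khintchine drift 0 levy z = z * phi z^-1.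
Proof.
move=> z0; rewrite /levy_khintchine -/(lk_integrand z).
have [-> _] := levy_khintchine_levy 0%:nng z0.
by rewrite rmorph0 mul0r addr0 addrC subrK.
Qed.

Lemma levy_khintchine_scale (z : R[i]) (s : {nonneg R}) : Im z < 0 ->
  levy_khintchine (s%:num * drift) (s%:num * 0) (mscale s levy) z = s%:num%:C * (z * phi z^-1).
Proof.
move=> z0; rewrite /levy_khintchine -/(lk_integrand z).
have [_ ->] := levy_khintchine_levy s z0.
by rewrite mulr0 rmorph0 mul0r addr0 rmorphM/=; ring.
Qed.

Lemma cone_inv (l M : R) (z : R[i]) : 0 < M -> truncated_cone l M (1 / z) -> z != 0 /\ Im z < 0.
Proof.
move=> M0 [+ _]; rewrite div1r => h; have u0 : 0 < Im z^-1 by apply: lt_trans h.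
have zn : z != 0 by rewrite -invr_eq0 Im_gt0_neq0.
split => //; move: u0; rewrite Im_inv pmulr_lgt0 ?oppr_gt0// invr_gt0 exprn_gt0// normc_gt0//.
Qed.

(** With g z = z + s phi z one has z g(1/z) - 1 = s z phi(1/z). *)
Lemma law_cumulant (s : R) (mu : probability (measurableTypeR R) R) :
  0 <= s -> free_law s mu ->
  exists2 M0, 0 < M0 & forall l M, M0 <= M ->
    free_cumulant_transform mu l M (fun z => s%:C * (z * phi z^-1)).
Proof.
move=> s0 /(law_F_inverse s0)[M0 M00 MF]; exists M0 => // l M MM.
exists (fun z => z + s%:C * phi z); first exact: MF.
move=> z /(cone_inv (lt_le_trans M00 MM))[zn _].
by rewrite div1r mulrDr divff// addrC addKr mulrCA.
Qed.

Lemma levy_null0 : @levy R [set 0%R] = 0%E.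
Proof. by apply: atomic_measure0 => k /= /eqP; rewrite gt_eqF// jump_gt0. Qed.

Lemma min_measurable : measurable_fun [set: measurableTypeR R] (fun t : R => Num.min 1 (t ^+ 2)).
Proof. by apply: measurable_minr => //; exact: exprn_measurable. Qed.

Lemma levy_min : (\int[@levy R]_t (Num.min 1 (t ^+ 2))%:E < +oo)%E.
Proof.
rewrite (@atomic_integral_ge0 _ _ _ _ E1) ?ltry//; first exact: min_measurable.
  by move=> t; rewrite le_min ler01 sqr_ge0.
move=> n; apply: le_trans (sum_levy_weight n); apply: ler_sum => k _.
by rewrite ler_piMr// ge_min lexx.
Qed.

Lemma jump_ge_nat k : k%:R <= @jump R k.
Proof.
rewrite /jump -natrX ler_nat (leq_trans (ltnW (ltn_expl k (ltnSn 1))))//.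
by rewrite leq_exp2l.
Qed.

(** Every open neighbourhood of a jump has positive mass. *)
Lemma levy_unbounded : ~ bounded_set (msupport (@levy R)).
Proof.
move=> [M [Mr hM]].
have /(hM _) : M < `|M| + 1 by rewrite ltr_pwDr// ler_norm.
pose k := (Num.truncn (`|M| + 1)).+1.
move=> /(_ (jump k)) => h.
have : `|jump k : R| <= `|M| + 1.
  apply: h => U oU Uk; apply: lt_le_trans (atomic_measure_pos _ _ Uk).
    by rewrite lte_fin levy_weightE divr_gt0 ?weight_gt0// exprn_gt0// jump_gt0.
  exact: open_measurable.
rewrite gtr0_norm ?jump_gt0// leNgt (lt_le_trans _ (jump_ge_nat k))//.
exact: truncnS_gt.
Qed.

Lemma law1_triplet (mu : probability (measurableTypeR R) R) : free_law 1 mu ->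
  free_characteristic_triplet mu drift 0 levy.
Proof.
move=> law; split => //; [exact: levy_null0|exact: levy_min|].
have [M0 M00 h] := law_cumulant ler01 law.
exists 1, M0, (fun z => 1%:C * (z * phi z^-1)); split => //; first exact: h.
move=> z /(cone_inv M00)[_ z0].
by rewrite levy_khintchine1// mul1r.
Qed.

Lemma law_triplet (s : {nonneg R}) (mu : probability (measurableTypeR R) R) :
  free_law s%:num mu ->
  free_characteristic_triplet mu (s%:num * drift) (s%:num * 0) (mscale s levy).
Proof.
move=> law; split; rewrite ?mulr0//.
- transitivity (s%:num%:E * @levy R [set 0%R])%E; first by [].
  by rewrite levy_null0 mule0.
- rewrite ge0_integral_mscale//; last 2 first.
  + by apply/measurable_EFinP; exact: min_measurable.
  + by move=> t _; rewrite lee_fin le_min ler01 sqr_ge0.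
  rewrite lte_mul_pinfty//; exact: levy_min.
have [M0 M00 h] := law_cumulant (ge0 s) law.
exists 1, M0, (fun z => s%:num%:C * (z * phi z^-1)); split => //; first exact: h.
move=> z /(cone_inv M00)[_ z0].
by have := levy_khintchine_scale s z0; rewrite mulr0 => ->.
Qed.

(** The three cumulant transforms are multiples of z phi(1/z), and a common
    cone is obtained by adding the three heights. *)
Lemma law_convolution (s1 s2 : R) (mu1 mu2 mu : probability (measurableTypeR R) R) :
  0 <= s1 -> 0 <= s2 -> free_law s1 mu1 -> free_law s2 mu2 -> free_law (s1 + s2) mu ->
  free_convolution mu1 mu2 mu.
Proof.
move=> h1 h2 /(law_cumulant h1)[M1 M10 c1] /(law_cumulant h2)[M2 M20 c2].
move=> /(law_cumulant (addr_ge0 h1 h2))[M M0 c].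
exists 1, (M1 + M2 + M), (fun z => s1%:C * (z * phi z^-1)), (fun z => s2%:C * (z * phi z^-1)),
  (fun z => (s1 + s2)%:C * (z * phi z^-1)); split.
- by split=> //; lra.
- by apply: c1; lra.
- by apply: c2; lra.
- by apply: c; lra.
- by move=> z _; rewrite rmorphD mulrDl.
Qed.

Lemma law_dirac0 : free_law 0 (\d_(0 : measurableTypeR R) : probability (measurableTypeR R) R).
Proof.
exists 1 => // z z1.
have z0 : 0 < Im z by apply: lt_trans z1.
suff E : F_transform (\d_(0 : measurableTypeR R) : probability (measurableTypeR R) R) z = z.
  by rewrite E mul0r addr0.
have m p : (forall v, `|p v| <= normc v) -> (forall v w, p (v - w) = p v - p w) ->
    \int[\d_(0 : measurableTypeR R)]_x p (1 / (z - x%:C)) = p z^-1.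
  move=> pn pB; rewrite /Rintegral integral_dirac//; last first.
    apply/measurable_EFinP; apply: (@lipschitz_measurable _ _ ((Im z)^-1 ^+ 2)) => t v.
    by rewrite -pB (le_trans (pn _))// resolvent_lip.
  by rewrite diracT mul1e/= subr0 div1r.
rewrite /F_transform /cauchy_transform /Cintegral.
rewrite (m (@complex.Re R)) ?(m (@complex.Im R)).
- by rewrite div1r; case: (z^-1) (invrK z) => a b /= ->.
- exact: normIm_le.
- by move=> v w; rewrite ImD ImN.
- exact: normRe_le.
- by move=> v w; rewrite ReD ReN.
Qed.

(** The partial free convolutions are the laws of exponents s, 2 s, ..., n s. *)
Lemma law_nfold (s : R) (mu sigma : probability (measurableTypeR R) R) n :
  0 < s -> free_law s mu -> free_law (s * n.+1%:R) sigma -> nfold_free_convolution mu n.+1 sigma.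
Proof.
move=> s0 law; elim: n sigma => [|n IH] sigma lawn.
  exists (\d_(0 : measurableTypeR R) : probability (measurableTypeR R) R); first by [].
  apply: (law_convolution (lexx 0) (ltW s0) law_dirac0 law).
  by rewrite add0r -[s]mulr1.
have sn : 0 < s * n.+1%:R by rewrite mulr_gt0.
have [tau [ltau _]] := law_with_gaps sn.
exists tau; first exact: IH.
apply: (law_convolution (ltW sn) (ltW s0) ltau law).
by rewrite -[X in _ + X]mulr1 -mulrDr natr1.
Qed.

Lemma law_fid (mu : probability (measurableTypeR R) R) : free_law 1 mu -> freely_infinitely_divisible mu.
Proof.
move=> law [//|n] _.
have sn : 0 < (n.+1%:R)^-1 :> R by rewrite invr_gt0.
have [tau [ltau _]] := law_with_gaps sn.
by exists tau; apply: (law_nfold sn ltau); rewrite mulVf ?pnatr_eq0.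
Qed.

End triplets.

(** * Moments from asymptotics along the imaginary axis *)

Section hamburger.
Context {R : realType}.
Variable mu : probability (measurableTypeR R) R.

(** The integral of damp y is the real part of z G(z) at z = iy. *)
Definition damp (y x : R) : R := y ^+ 2 / (x ^+ 2 + y ^+ 2).

Lemma damp_den (y x : R) : 0 < y -> 0 < x ^+ 2 + y ^+ 2.
Proof. by move=> y0; rewrite ltr_wpDl ?sqr_ge0// exprn_gt0. Qed.

Lemma damp_ge0 y x : 0 <= damp y x.
Proof. by rewrite divr_ge0 ?addr_ge0 ?sqr_ge0. Qed.

Lemma damp_le1 y x : 0 < y -> damp y x <= 1.
Proof. by move=> y0; rewrite ler_pdivrMr ?damp_den// mul1r lerDr sqr_ge0. Qed.

Lemma damp_measurable y : 0 < y -> measurable_fun [set: measurableTypeR R] (damp y).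
Proof.
move=> y0; apply: continuous_measurable_fun => x.
apply: cvgM; first exact: cvg_cst.
apply: cvgV; first by rewrite gt_eqF// damp_den.
by apply: cvgD; [exact: exprn_continuous|exact: cvg_cst].
Qed.

Lemma damp_nd (m n : nat) x : (m <= n)%N -> damp m.+1%:R x <= damp n.+1%:R x.
Proof.
move=> mn; rewrite /damp ler_pdivrMr ?damp_den// mulrAC ler_pdivlMr ?damp_den//.
have : m.+1%:R ^+ 2 <= n.+1%:R ^+ 2 :> R by rewrite lerXn2r ?nnegrE// ler_nat.
move: (m.+1%:R ^+ 2) (n.+1%:R ^+ 2) (sqr_ge0 x) => a b x0 ab.
by rewrite 2!mulrDr [b * a]mulrC lerD2r ler_wpM2r.
Qed.

Lemma damp_rec y x : 0 < y -> x ^+ 2 * damp y x = y ^+ 2 * (1 - damp y x).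
Proof. by move=> y0; rewrite /damp; field; rewrite gt_eqF// damp_den. Qed.

Lemma inv_sqr_cvg0 : (fun n : nat => - (n.+1%:R ^- 2 : R)) @ \oo --> (0 : R).
Proof.
rewrite -[X in _ --> X]oppr0; apply: cvgN.
apply: (@squeeze_cvgr _ _ _ _ (cst 0) (fun n => n.+1%:R^-1)).
- apply: nearW => n /=; rewrite invr_ge0 exprn_ge0//= -exprVn expr2.
  by rewrite ler_piMr// ?invf_le1// ?ler1n// invr_ge0.
- exact: cvg_cst.
- exact: cvg_harmonic.
Qed.

Lemma damp_cvg1 x : (fun n : nat => damp n.+1%:R x) @ \oo --> (1 : R).
Proof.
rewrite (_ : (fun n => _) = (fun n : nat => (1 - x ^+ 2 * - (n.+1%:R ^- 2))^-1)).
  rewrite -[X in _ --> X]invr1; apply: cvgV; first by rewrite oner_eq0.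
  rewrite -[X in _ --> X]subr0; apply: cvgB; first exact: cvg_cst.
  rewrite -[X in _ --> X](mulr0 (x ^+ 2)); apply: cvgM; first exact: cvg_cst.
  exact: inv_sqr_cvg0.
apply/funext => n; rewrite /damp mulrN opprK.
have n0 : (n.+1%:R : R) != 0 by rewrite pnatr_eq0.
have d0 := damp_den x (ltr0Sn R n).
move: (n.+1%:R ^+ 2) (expf_neq0 2 n0) d0 => b b0 d0.
by field; rewrite b0 ?andbT/= addrC gt_eqF.
Qed.

(** This increases to x ^+ (2 * k) when y tends to infinity. *)
Definition even_damp k y x : R := x ^+ (2 * k) * damp y x.

Lemma even_damp_measurable k y : 0 < y -> measurable_fun [set: measurableTypeR R] (even_damp k y).
Proof. by move=> y0; apply: measurable_funM; [exact: exprn_measurable|exact: damp_measurable]. Qed.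

Lemma even_ge0 k (x : R) : 0 <= x ^+ (2 * k).
Proof. by rewrite exprM exprn_ge0// sqr_ge0. Qed.

Lemma even_damp_ge0 k y x : 0 <= even_damp k y x.
Proof. by rewrite mulr_ge0 ?damp_ge0// even_ge0. Qed.

Lemma even_damp_cvg k : ((\int[mu]_x (even_damp k n.+1%:R x)%:E)%E @[n --> \oo] -->
  \int[mu]_x (x ^+ (2 * k))%:E)%E.
Proof.
have -> : (\int[mu]_x (x ^+ (2 * k))%:E =
    \int[mu]_x (limn (fun n : nat => (even_damp k n.+1%:R x)%:E)))%E.
  apply: eq_integral => x _; apply/esym/cvg_lim => //; apply/cvg_EFin; first exact: nearW.
  rewrite -[X in _ --> X]mulr1; apply: cvgM; first exact: cvg_cst.
  exact: damp_cvg1.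
apply: cvg_monotone_convergence => //.
- by move=> n; apply/measurable_EFinP; exact: even_damp_measurable.
- by move=> n x _; rewrite lee_fin even_damp_ge0.
- by move=> x _ m n mn; rewrite lee_fin ler_wpM2l ?damp_nd// even_ge0.
Qed.

Variables (E : {poly R}) (N : nat) (C y0 : R).
Hypothesis y01 : 1 <= y0.
Hypothesis hE : forall y, y0 <= y ->
  `|\int[mu]_x damp y x - E.[- y ^- 2]| <= C * (y ^- 2) ^+ N.+1.

Lemma drop_poly_rec k : drop_poly k E = (E`_k)%:P + 'X * drop_poly k.+1 E.
Proof.
apply/polyP => -[|i]; rewrite coef_drop_poly coefD coefC coefXM/=; first by rewrite addr0.
by rewrite coef_drop_poly add0r addSnnS.
Qed.

(** By monotone convergence the moment of order 2 k is the limit of the damped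
    moments, that is, the constant term of their expansion. *)
Lemma even_moment k : (k <= N)%N ->
  (forall y, y0 <= y -> mu.-integrable setT (EFin \o even_damp k y)) ->
  (forall y, y0 <= y -> `|\int[mu]_x even_damp k y x - (drop_poly k E).[- y ^- 2]|
     <= C * (y ^- 2) ^+ (N.+1 - k)) ->
  (\int[mu]_x (x ^+ (2 * k))%:E = (E`_k)%:E)%E.
Proof.
move=> kN ik ek; apply: (cvg_unique _ (@even_damp_cvg k)); first exact: ereal_hausdorff.
have [n0 hn0] : exists n0 : nat, y0 <= n0%:R.
  by exists (Num.truncn y0).+1; rewrite ltW// truncnS_gt.
have big : \forall n \near \oo, y0 <= n.+1%:R.
  by exists n0 => // n /= n0n; rewrite (le_trans hn0)// ler_nat ltnW.
have : \int[mu]_x even_damp k n.+1%:R x @[n --> \oo] --> E`_k.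
  have h0 : (drop_poly k E).[- n.+1%:R ^- 2] @[n --> \oo] --> E`_k.
    have -> : E`_k = (drop_poly k E).[0] by rewrite drop_poly_rec !hornerE.
    by apply: continuous_cvg; [exact: continuous_horner|exact: inv_sqr_cvg0].
  have h1 : \int[mu]_x even_damp k n.+1%:R x - (drop_poly k E).[- n.+1%:R ^- 2]
      @[n --> \oo] --> (0 : R).
    apply/norm_cvg0P; apply: (@squeeze_cvgr _ _ _ _ (cst 0) (fun n : nat => C * - - (n.+1%:R ^- 2))).
    - near=> n; rewrite normr_ge0/= opprK.
      have yn : y0 <= n.+1%:R by near: n.
      rewrite (le_trans (ek _ yn))//.
      have C0 : 0 <= C.
        have := le_trans (normr_ge0 _) (ek _ yn); rewrite pmulr_lge0// exprn_gt0// invr_gt0 exprn_gt0//.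
      rewrite ler_wpM2l// subSn// exprS ler_piMr ?invr_ge0 ?exprn_ge0//.
      by rewrite exprn_ile1 ?invr_ge0 ?exprn_ge0// invf_le1 ?exprn_gt0// exprn_ege1// ler1n.
    - exact: cvg_cst.
    - rewrite -[X in _ --> X](mulr0 C); apply: cvgM; first exact: cvg_cst.
      by rewrite -oppr0; apply: cvgN; exact: inv_sqr_cvg0.
  rewrite (_ : (fun n => _) = (fun n : nat => \int[mu]_x even_damp k n.+1%:R x
      - (drop_poly k E).[- n.+1%:R ^- 2] + (drop_poly k E).[- n.+1%:R ^- 2])).
    by rewrite -[X in _ --> X]add0r; exact: cvgD.
  by apply/funext => n; rewrite subrK.
move=> h; have h' : (\int[mu]_x even_damp k n.+1%:R x)%:E @[n --> \oo] --> (E`_k)%:E.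
  by apply/cvg_EFin => //; exact: nearW.
apply: (cvg_trans _ h'); apply: near_eq_cvg; apply: filterS big => n yn.
by rewrite /Rintegral fineK//; exact: (integrable_fin_num measurableT (ik _ yn)).
Unshelve. all: by end_near. Qed.

(** This is x^2 y^2 / (x^2 + y^2) = y^2 (1 - y^2 / (x^2 + y^2)), multiplied by
    x^(2k) and integrated; it needs the moment of order 2 k to be finite. *)
Lemma even_damp_rec k y : y0 <= y -> (\int[mu]_x (x ^+ (2 * k))%:E = (E`_k)%:E)%E ->
  mu.-integrable setT (EFin \o even_damp k y) ->
  mu.-integrable setT (EFin \o even_damp k.+1 y) /\
  \int[mu]_x even_damp k.+1 y x = y ^+ 2 * (E`_k - \int[mu]_x even_damp k y x).
Proof.
move=> yy mk ik.
have y1 : 0 < y by rewrite (lt_le_trans _ (le_trans y01 yy)).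
have xi : mu.-integrable setT (EFin \o (fun x : R => x ^+ (2 * k))).
  apply/integrableP; split; first by apply/measurable_EFinP; exact: exprn_measurable.
  apply: (@le_lt_trans _ _ (\int[mu]_x (x ^+ (2 * k))%:E)%E); last by rewrite mk ltry.
  by rewrite le_eqVlt; apply/orP; left; apply/eqP; apply: eq_integral => x _; rewrite gee0_abs// lee_fin even_ge0.
have Ek : even_damp k.+1 y = (fun x => y ^+ 2 * (x ^+ (2 * k) - even_damp k y x)).
  apply/funext => t; rewrite /even_damp mulnS exprD [t ^+ 2 * _]mulrC -mulrA damp_rec//.
  by ring.
have di : mu.-integrable setT (EFin \o (fun x => x ^+ (2 * k) - even_damp k y x)).
  exact: (integrableB measurableT xi ik).
split; first by rewrite Ek; exact: integrable_scale.
rewrite Ek RintegralZl// RintegralB//; congr (_ * (_ - _)).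
by rewrite /Rintegral mk.
Qed.

(** An expansion of the damped total mass in powers of -1/y^2 determines the
    even moments. Subtracting the constant term from the expansion for k and
    dividing by -1/y^2 gives the expansion for k + 1, with one order less;
    drop_poly k E is the polynomial that remains after k steps. *)
Theorem even_moments k : (k <= N)%N -> (\int[mu]_x (x ^+ (2 * k))%:E = (E`_k)%:E)%E.
Proof.
move=> kN.
suff [h1 h2] : (forall y, y0 <= y -> mu.-integrable setT (EFin \o even_damp k y)) /\
  (forall y, y0 <= y -> `|\int[mu]_x even_damp k y x - (drop_poly k E).[- y ^- 2]|
     <= C * (y ^- 2) ^+ (N.+1 - k)) by exact: even_moment.
elim: k kN => [_|k IH kN].
  split=> y yy.
    have y1 : 0 < y by rewrite (lt_le_trans _ (le_trans y01 yy)).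
    apply: (@bounded_integrable _ _ _ 1); first exact: even_damp_measurable.
    by move=> x; rewrite ger0_norm ?even_damp_ge0// /even_damp muln0 expr0 mul1r damp_le1.
  rewrite subn0 (_ : drop_poly 0 E = E); last by apply/polyP => i; rewrite coef_drop_poly addn0.
  by under eq_Rintegral do rewrite /even_damp muln0 expr0 mul1r; exact: hE.
have [ik ek] := IH (ltnW kN).
have mk := even_moment (ltnW kN) ik ek.
split=> y yy; have [i1 E1] := even_damp_rec yy mk (ik y yy); first exact: i1.
have y1 : 0 < y by rewrite (lt_le_trans _ (le_trans y01 yy)).
have y2 : y ^+ 2 != 0 by rewrite gt_eqF// exprn_gt0.
have := ek y yy; rewrite E1 (drop_poly_rec k) !hornerE => h.
have -> : y ^+ 2 * (E`_k - \int[mu]_x even_damp k y x) - (drop_poly k.+1 E).[- y ^- 2] =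
  - y ^+ 2 * (\int[mu]_x even_damp k y x - (E`_k - y ^- 2 * (drop_poly k.+1 E).[- y ^- 2])).
  by rewrite mulNr !mulrBr mulrA divff// mul1r; ring.
rewrite normrM normrN (ger0_norm (exprn_ge0 _ (ltW y1))).
move: h; rewrite subSn 1?ltnW// => h.
apply: (@le_trans _ _ (y ^+ 2 * (C * (y ^- 2) ^+ (N - k).+1))).
  by rewrite ler_wpM2l ?exprn_ge0 ?(ltW y1)//; apply: le_trans h; rewrite mulNr.
by rewrite [(y ^- 2) ^+ (N - k).+1]exprS mulrCA [y ^+ 2 * (_ * _)]mulrA divff// mul1r subSS.
Qed.

End hamburger.

(** * Asymptotic expansion of the Cauchy transform *)

Section expansion.
Context {R : realType}.

(** The moment of order j of sum_k w_k delta_{x_k}, which is, up to the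
    factor s, the free cumulant of order j + 2 of the power of exponent s. *)
Definition sigma_moment j : R := limn (fun n => \sum_(k < n) @weight R k * jump k ^+ j).

Lemma sigma_moment_cvg j : (fun n => \sum_(k < n) @weight R k * jump k ^+ j) @ \oo --> sigma_moment j.
Proof.
apply: nondecreasing_is_cvgn; last by exists (moment_bound j) => _ [n _ <-]; exact: sum_weight_jump.
apply/nondecreasing_seqP => n; rewrite big_ord_recr/= lerDl mulr_ge0//.
  exact: ltW (weight_gt0 _).
by rewrite exprn_ge0// ltW// jump_gt0.
Qed.

Lemma sigma_moment_ge i j : weight i * jump i ^+ j <= sigma_moment j.
Proof.
apply: (cvgr_to_ge (@sigma_moment_cvg j) (b := weight i * jump i ^+ j)); exists i.+1 => // n /= ni.
have pos k : 0 <= @weight R k * jump k ^+ j.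
  by rewrite mulr_ge0 ?exprn_ge0 ?(ltW (jump_gt0 _)) ?(ltW (weight_gt0 _)).
by rewrite (bigD1 (Ordinal ni))//= lerDl sumr_ge0.
Qed.

Lemma sigma_moment_ge0 j : 0 <= sigma_moment j.
Proof.
apply: le_trans (sigma_moment_ge 0 j).
by rewrite mulr_ge0 ?exprn_ge0 ?(ltW (jump_gt0 _)) ?(ltW (weight_gt0 _)).
Qed.

(** Expand 1 / (w - x_k) as a geometric sum with remainder
    x_k^N / (w^N (w - x_k)). *)
Lemma phi_expansion N (w : R[i]) : 0 < Im w -> exists2 r : R[i],
  phi w = \sum_(j < N) (sigma_moment j)%:C * w^-1 ^+ j.+1 + w^-1 ^+ N * r &
  normc r <= moment_bound N / Im w.
Proof.
move=> w0; have wn : w != 0 by rewrite Im_gt0_neq0.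
pose c N k : R := weight k * jump k ^+ N.
have c0 M k : 0 < c M k by rewrite mulr_gt0 ?weight_gt0 ?exprn_gt0 ?jump_gt0.
suff [r h1 h2] : exists2 r : R[i],
    phi w = \sum_(j < N) (sigma_moment j)%:C * w^-1 ^+ j.+1 + w^-1 ^+ N * r &
    cvgC \oo (fun n => pick_sum (c N) jump n w) r.
  exists r => //; apply: (cvgC_normc_le _ h2); apply: nearW => n.
  exact: (pick_sum_le jump (c0 N) (@sum_weight_jump R N)).
elim: N => [|N [r h1 h2]].
  exists (phi w); first by rewrite big_ord0 add0r expr0 mul1r.
  rewrite (_ : (fun n => _) = (fun n => pick_sum weight jump n w)); first exact: phi_lim.
  by apply/funext => n; apply: eq_bigr => k _; rewrite /c expr0 mulr1.
exists (w * r - (sigma_moment N)%:C).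
  rewrite h1 big_ord_recr/= -addrA; congr (_ + _); rewrite exprS mulrBr.
  by rewrite [w^-1 * w^-1 ^+ N * (w * r)]mulrACA mulVf// mul1r; ring.
rewrite (_ : (fun n => _) = (fun n => w * pick_sum (c N) jump n w - (\sum_(k < n) c N k)%:C)).
  apply: cvgCD; first exact: cvgCZ.
  apply: cvgCN; apply: cvgC_ReIm => /=; first exact: sigma_moment_cvg.
  exact: cvg_cst.
apply/funext => n; rewrite /pick_sum mulr_sumr rmorph_sum -sumrB; apply: eq_bigr => k _.
have nt : w - (jump k)%:C != 0 by rewrite subr_eq0 Im_gt0_neq_real.
rewrite /c exprS !rmorphM/=.
by rewrite rmorphXn/=; field; move: nt; rewrite /jump rmorphXn.
Qed.

Lemma normc_subX (a b : R[i]) (D : R) m : 1 <= D -> normc a <= D -> normc b <= D ->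
  normc (a ^+ m - b ^+ m) <= m%:R * D ^+ m * normc (a - b).
Proof.
move=> D1 aD bD; have D0 : 0 <= D by rewrite (le_trans _ D1).
elim: m => [|m IH]; first by rewrite !expr0 subrr normc0 !mul0r.
have -> : a ^+ m.+1 - b ^+ m.+1 = a * (a ^+ m - b ^+ m) + b ^+ m * (a - b).
  by rewrite !exprS; ring.
rewrite (le_trans (normcD_le _ _))// !normcM normcX -natr1 mulrDl mul1r mulrDl lerD//.
  rewrite exprS [_ * (D * _)]mulrCA -mulrA ler_pM ?normc_ge0//.
rewrite ler_wpM2r ?normc_ge0// (@le_trans _ _ (D ^+ m))//.
  by rewrite lerXn2r ?nnegrE ?normc_ge0.
by rewrite ler_weXn2l.
Qed.

(** Stable under sums and products, so that a coefficient of a sum of products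
    is bounded below by the contribution of any single term. *)
Definition nn_coefs (P : {poly R}) := forall i, 0 <= P`_i.

Lemma nn_coefsM P Q : nn_coefs P -> nn_coefs Q -> nn_coefs (P * Q).
Proof. by move=> P0 Q0 i; rewrite coefM sumr_ge0// => j _; rewrite mulr_ge0. Qed.

Lemma nn_coefsX P n : nn_coefs P -> nn_coefs (P ^+ n).
Proof.
move=> P0; elim: n => [|n IH]; last by rewrite exprS; exact: nn_coefsM.
by move=> i; rewrite expr0 coefC; case: eqP.
Qed.

Definition cpoly (P : {poly R}) : {poly R[i]} := map_poly (real_complex R) P.

Variables (s : R) (mu : probability (measurableTypeR R) R) (H : R).
Hypothesis s_gt0 : 0 < s.
Hypothesis H0 : 0 < H.
Hypothesis lawE : forall z, H < Im z -> Im z <= Im (F_transform mu z) /\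
    F_transform mu z + s%:C * phi (F_transform mu z) = z.

Let G z := cauchy_transform mu z.
Let imag (y : R) : R[i] := 0 +i* y.

Lemma G_facts y : H + 1 <= y -> let w := F_transform mu (imag y) in
  [/\ G (imag y) = w^-1, y <= Im w, normc (G (imag y)) <= y^-1 &
    imag y * G (imag y) = 1 + s%:C * (G (imag y) * phi w)].
Proof.
move=> yH w; have y0 : 0 < y by apply: lt_le_trans yH; rewrite addr_gt0.
have yH' : H < Im (imag y) by rewrite (lt_le_trans _ yH)// ltrDl.
have [yw wz] := lawE yH'; rewrite -/w in yw wz.
have GE : G (imag y) = w^-1 by rewrite /w /F_transform div1r invrK.
have wn : w != 0 by rewrite Im_gt0_neq0// (lt_le_trans y0).
split => //.
  by rewrite GE -[X in normc X^-1]subr0 (normc_inv_le 0 y0 yw).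
by rewrite GE -{1}wz mulrDl divff// [w^-1 * _]mulrC mulrA.
Qed.

Lemma imag_inv_normc y : 0 < y -> normc (imag y)^-1 = y^-1.
Proof. by move=> y0; rewrite normcV /= expr0n add0r sqrtr_sqr gtr0_norm. Qed.

Lemma imag_neq0 y : 0 < y -> imag y != 0.
Proof. by move=> y0; rewrite Im_gt0_neq0. Qed.

(** Multiplying F + s phi(F) = z by G = 1/F and expanding phi gives
    z G = 1 + s sum_(j<=N) sigma_moment j G^(j+2) + O(y^-(N+2)). If z G is
    P(1/z) up to order N, then G is (X P)(1/z) up to order N + 1, and
    substituting this in the right-hand side gives the next polynomial,
    1 + s sum_j sigma_moment j (X P)^(j+2). The term j contributes at least
    s sigma_moment j to the coefficient of order j + 2 because P has constant
    term 1. *)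
Lemma zG_expansion N : exists P : {poly R}, exists2 C : R, 0 <= C &
  [/\ nn_coefs P, P`_0 = 1,
   (forall j, (j < N)%N -> s * sigma_moment j <= P`_j.+2) &
   forall y, H + 1 <= y -> normc (imag y * G (imag y) - (cpoly P).[(imag y)^-1]) <= C * y^-1 ^+ N].
Proof.
have y1 y : H + 1 <= y -> 1 <= y by apply: le_trans; rewrite lerDr ltW.
have y0 y : H + 1 <= y -> 0 < y by move=> /y1; exact: lt_le_trans.
elim: N => [|N [P [C C0 [Pn P0 Pm PC]]]].
  exists 1, (s * expR 1); first by rewrite mulr_ge0 ?expR_ge0// ltW.
  split; [by move=> i; rewrite coefC; case: eqP|by rewrite coefC|by []|move=> y yH].
  have [GE yw Gy ->] := G_facts yH; rewrite /cpoly rmorph1 hornerC addrAC subrr add0r.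
  rewrite expr0 mulr1 normcM normc_real gtr0_norm// ler_pM2l// normcM -[leRHS]mul1r.
  rewrite ler_pM ?normc_ge0//; first by rewrite (le_trans Gy)// invf_le1 ?y1 ?y0.
  by rewrite (le_trans (phi_le1 ltr01 (le_trans (y1 _ yH) yw)))// divr1.
pose Q := \sum_(j < N.+1) (s * sigma_moment j) *: ('X * P) ^+ j.+2.
have XPn : nn_coefs ('X * P).
  by apply: nn_coefsM => // i; rewrite coefX; case: eqP.
have sm j : 0 <= s * sigma_moment j by rewrite mulr_ge0 ?sigma_moment_ge0// ltW.
have tn j : nn_coefs ((s * sigma_moment j) *: ('X * P) ^+ j.+2).
  by move=> i; rewrite coefZ mulr_ge0//; exact: nn_coefsX.
have Qn : nn_coefs Q by move=> i; rewrite coef_sum sumr_ge0// => j _; exact: tn.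
(* D bounds both G and its approximation, as |G| <= 1/y <= 1 *)
pose D := 1 + C; have D1 : 1 <= D by rewrite lerDl.
pose K j : R := s * sigma_moment j * (j.+2%:R * D ^+ j.+2 * C).
have D0 : 0 <= D by rewrite (le_trans _ D1).
have K0 j : 0 <= K j.
  by rewrite /K mulr_ge0 ?sm// mulr_ge0// mulr_ge0// exprn_ge0.
have mb0 : 0 <= moment_bound N.+1 :> R by rewrite mulr_ge0 ?exprn_ge0 ?expR_ge0.
exists (1 + Q), (\sum_(j < N.+1) K j + s * moment_bound N.+1).
  by rewrite addr_ge0 ?sumr_ge0// mulr_ge0// ltW.
split.
- by move=> i; rewrite coefD addr_ge0// coefC; case: eqP.
- rewrite coefD coefC/= -horner_coef0 /Q horner_sum big1 ?addr0// => j _.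
  by rewrite hornerZ horner_exp hornerM hornerX mul0r expr0n mulr0.
- move=> j jN; rewrite coefD coefC/= add0r /Q coef_sum.
  rewrite (bigD1 (Ordinal jN))//= coefZ exprMn coefXnM ltnn subnn.
  rewrite -horner_coef0 horner_exp horner_coef0 P0 expr1n mulr1 lerDl sumr_ge0// => i _.
  exact: tn.
move=> y yH; have yy := y0 y yH; have [GE yw Gy ->] := G_facts yH.
set w := F_transform mu (imag y) in GE yw *; set g := G (imag y) in GE Gy *.
have w0 : 0 < Im w by apply: lt_le_trans yw.
pose u := (imag y)^-1; pose q := (cpoly ('X * P)).[u].
have qE : q = u * (cpoly P).[u] by rewrite /q /cpoly rmorphM/= map_polyX hornerM hornerX.
have gq : normc (g - q) <= C * y^-1 ^+ N.+1.
  have -> : g - q = u * (imag y * g - (cpoly P).[u]).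
    by rewrite qE mulrBr mulrA /u mulVf ?imag_neq0// mul1r.
  rewrite normcM imag_inv_normc// exprS mulrCA ler_wpM2l ?invr_ge0 ?(ltW yy)//.
  exact: PC.
have yi1 : y^-1 <= 1 by rewrite invf_le1 ?y1.
have yi0 : 0 <= y^-1 by rewrite invr_ge0 ltW.
have gD : normc g <= D by rewrite (le_trans Gy)// (le_trans yi1).
have qD : normc q <= D.
  rewrite -[q](subrK g) (le_trans (normcD_le _ _))// addrC lerD//.
    by rewrite (le_trans Gy).
  by rewrite normcB (le_trans gq)// ler_piMr// exprn_ile1.
have [r phiE rB] := phi_expansion N.+1 w0.
have QE : (cpoly (1 + Q)).[u] = 1 + \sum_(j < N.+1) (s * sigma_moment j)%:C * q ^+ j.+2.
  rewrite /cpoly rmorphD rmorph1 hornerD hornerC /Q rmorph_sum horner_sum; congr (_ + _).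
  by apply: eq_bigr => j _; rewrite /= map_polyZ/= hornerZ rmorphXn horner_exp.
have -> : 1 + s%:C * (g * phi w) - (cpoly (1 + Q)).[u] =
    \sum_(j < N.+1) (s * sigma_moment j)%:C * (g ^+ j.+2 - q ^+ j.+2) + s%:C * (g ^+ N.+2 * r).
  rewrite QE phiE -GE mulrDr mulrDr opprD addrACA subrr add0r addrAC; congr (_ + _).
    rewrite !mulr_sumr -sumrB; apply: eq_bigr => j _.
    by rewrite rmorphM mulrBr [g ^+ j.+2]exprS; ring.
  by rewrite [g ^+ N.+2]exprS; ring.
rewrite (le_trans (normcD_le _ _))// mulrDl lerD//.
  rewrite (le_trans (normc_sum _ _))// mulr_suml; apply: ler_sum => j _.
  rewrite normcM normc_real ger0_norm// /K -[leRHS]mulrA ler_wpM2l//.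
  rewrite (le_trans (normc_subX _ D1 gD qD))// -[leRHS]mulrA.
  by rewrite ler_wpM2l// mulr_ge0// exprn_ge0.
rewrite normcM normc_real gtr0_norm// -mulrA ler_pM2l// normcM normcX mulrC.
rewrite ler_pM ?exprn_ge0 ?normc_ge0//.
  rewrite (le_trans rB)// ler_pdivrMr// ler_peMr// (le_trans _ yw)// y1//.
rewrite (@le_trans _ _ (y^-1 ^+ N.+2))//; first by rewrite lerXn2r ?nnegrE ?normc_ge0.
by rewrite ler_wiXn2l.
Qed.

Lemma damp_cauchy y : 0 < y -> \int[mu]_x damp y x = Re (imag y * G (imag y)).
Proof.
move=> y0.
have E1 x : Im (1 / (imag y - x%:C)) = - y^-1 * damp y x.
  have := damp_den x y0 => d0.
  by rewrite div1r Im_inv normc_sqr/= sub0r subr0 sqrrN /damp; field; rewrite !gt_eqF.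
have i1 : mu.-integrable setT (EFin \o damp y).
  apply: (@bounded_integrable _ _ _ 1); first exact: damp_measurable.
  by move=> x; rewrite ger0_norm ?damp_ge0// damp_le1.
have GI : Im (G (imag y)) = - y^-1 * \int[mu]_x damp y x.
  rewrite /G /cauchy_transform /Cintegral/= -RintegralZl//.
  by apply: eq_Rintegral => x _; exact: E1.
have -> : Re (imag y * G (imag y)) = - y * Im (G (imag y)).
  by case: (G (imag y)) => a b /=; rewrite mul0r sub0r mulNr.
by rewrite GI mulrA mulrNN divff ?mul1r// gt_eqF.
Qed.

(** (1/z)^2 = -1/y^2 is real and 1/z is purely imaginary. *)
Lemma cpoly_even P y : 0 < y -> Re (cpoly P).[(imag y)^-1] = (even_poly P).[- y ^- 2].
Proof.
move=> y0; set u := (imag y)^-1.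
have u2 : u ^+ 2 = (- y ^- 2)%:C.
  rewrite /u exprVn -[RHS]invrK; congr (_^-1).
  by rewrite -fmorphV invrN invrK; apply: eqC_ReIm => /=; ring.
have uR : Re u = 0 by rewrite /u Re_inv mul0r.
rewrite -{1}(poly_even_odd P) /cpoly rmorphD rmorphM/= !map_comp_poly map_polyXn map_polyX.
rewrite hornerD hornerM hornerX !horner_comp hornerXn u2 ReD !horner_map.
by rewrite ReZ uR mulr0 addr0.
Qed.

Theorem law_even_moments k : exists m : R,
  (\int[mu]_x (x ^+ (2 * k.+1))%:E = m%:E)%E /\
  forall i, s * (weight i * jump i ^+ (2 * k)) <= m.
Proof.
(* the error y^-(2k+4) is (y^-2)^(k+2), what even_moments asks at order k + 1 *)
have [P [C C0 [_ _ Pm PC]]] := zG_expansion (2 * k.+2).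
exists (even_poly P)`_k.+1; split; last first.
  move=> i; rewrite coef_even_poly doubleS -mul2n.
  by apply: le_trans (Pm (2 * k)%N _); rewrite ?ler_pM2l ?sigma_moment_ge// ltn_mul2l/= ltnS leqnSn.
apply: (@even_moments _ mu _ k.+1 C (H + 1)) => //; first by rewrite lerDr ltW.
move=> y yH; have y0 : 0 < y by apply: lt_le_trans yH; rewrite addr_gt0.
rewrite damp_cauchy// -cpoly_even// -ReN -ReD (le_trans (normRe_le _))//.
by rewrite (le_trans (PC _ yH))// exprM exprVn.
Qed.

End expansion.

(** * Gaps, unimodality and boundedness of the support *)

Section non_unimodality.
Context {R : realType}.
Variables (s : R) (mu : probability (measurableTypeR R) R).
Hypothesis s_gt0 : 0 < s.
Hypothesis law : free_law s mu.
Hypothesis gaps : forall a b, (forall t, a < t < b -> off_jumps s t) ->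
  mu `]a, b[%classic = 0%E.

Let L := s * expR 1 + 2.

Let L2 : 2 <= L. Proof. by rewrite lerDr mulr_ge0 ?expR_ge0// ltW. Qed.

Lemma jump_nd (i j : nat) : (i <= j)%N -> @jump R i <= jump j.
Proof. by move=> ij; rewrite /jump ler_weXn2l// ler1n. Qed.

Lemma jumpS k : @jump R k.+1 = 2 * jump k.
Proof. by rewrite /jump exprS. Qed.

(** The jumps increase, so the nearest ones are jump k and jump k.+1. *)
Lemma gap_between k t : jump k + L < t -> t < jump k.+1 - L -> off_jumps s t.
Proof.
move=> h1 h2; have k2 := jump_ge2 (R := R) k; have hL := L2; split.
  by rewrite gtr0_norm; lra.
move=> j; have [jk|kj] := leqP j k.
  by have := jump_nd jk; rewrite -/L => h; rewrite ler_normr; apply/orP; left; lra.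
by have := jump_nd kj; rewrite -/L => h; rewrite ler_normr; apply/orP; right; lra.
Qed.

Lemma gap_left t : t < - L -> off_jumps s t.
Proof.
move=> tL; have hL := L2; split; first by rewrite ltr_normr; apply/orP; right; lra.
by move=> k; have := jump_ge2 (R := R) k; rewrite -/L => h; rewrite ler_normr; apply/orP; right; lra.
Qed.

Lemma null_left : mu `]-oo, (- L)[%classic = 0%E.
Proof.
have -> : (`]-oo, (- L)[%classic : set R) = \bigcup_(n : nat) `]- n%:R, - L[%classic.
  apply/seteqP; split => [t|t [n _]] /=; rewrite !in_itv/=; last by case/andP.
  move=> tL; exists (Num.truncn `|t|).+1 => //=; rewrite in_itv/= tL andbT ltrNl.
  by rewrite (le_lt_trans _ (truncnS_gt _))// -normrN ler_norm.
apply: measure_negligible; first by apply: bigcup_measurable => n _; exact: measurable_itv.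
apply: negligible_bigcup => n; apply/negligibleP; first exact: measurable_itv.
by apply: gaps => t /andP[_]; exact: gap_left.
Qed.

(** Beyond the mode there is a gap ]a, b[ of the measure. The density is
    nonincreasing there with integral zero, so it vanishes at the midpoint of
    the gap and therefore everywhere beyond. *)
Lemma unimodal_bounded : unimodal mu -> exists B, mu `]B, +oo[%classic = 0%E.
Proof.
move=> [c [f [f0 fl fr dens]]].
have hL := L2.
have [k hk] : exists k, 2 * L + `|c| < jump k.
  exists (Num.truncn (2 * L + `|c|)).+1.
  by rewrite (lt_le_trans (truncnS_gt _))// jump_ge_nat.
pose a := jump k + L; pose b := jump k.+1 - L.
have ca : c < a by have := ler_norm c; rewrite /a; lra.
have ab : a < b by rewrite /a /b jumpS; have := normr_ge0 c; lra.
have mass (A : set (measurableTypeR R)) : measurable A -> ~ A c ->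
    (mu A = \int[lebesgue_measure]_(t in A) (f t)%:E)%E.
  by move=> mA Ac; rewrite dens// diracE memNset// mule0 add0e.
pose m := (a + b) / 2.
have am : a < m by rewrite /m; lra.
have mb : m < b by rewrite /m; lra.
(* f made monotone on the whole line, hence measurable *)
pose g t := f (Num.max a t).
have gni : nonincreasing_fun g.
  move=> t u tu; apply: fr; first by rewrite lt_max ca.
  by rewrite ge_max !le_max lexx tu orbT.
have gE t : a < t -> g t = f t by move=> /ltW at_; rewrite /g max_r.
have f_m : f m = 0.
  apply/eqP; rewrite eq_le f0 andbT leNgt; apply/negP => fm.
  have := gaps (a := a) (b := b) (fun t h => gap_between (proj1 (andP h)) (proj2 (andP h))).
  rewrite mass; last 2 first.
  - exact: measurable_itv.
  - by rewrite /= in_itv/= => /andP[]; rewrite ltNge (ltW ca).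
  move=> I0.
  have : ((f m)%:E * (m - a)%:E <= 0 :> \bar R)%E.
    have <- : (\int[lebesgue_measure]_(t in `]a, b[) (g t)%:E = 0)%E.
      by rewrite -[RHS]I0; apply: eq_integral => t; rewrite inE/= in_itv/= => /andP[/gE ->].
    have mg (D : set R) : measurable D -> measurable_fun D (EFin \o g).
      by move=> mD; apply/measurable_EFinP; exact: nonincreasing_measurable.
    apply: (@le_trans _ _ (\int[lebesgue_measure]_(t in `]a, m[) (g t)%:E)%E).
      have -> : ((f m)%:E * (m - a)%:E = \int[lebesgue_measure]_(t in `]a, m[) (f m)%:E)%E.
        rewrite integral_cst//=.
        by rewrite lebesgue_measure_itv/= lte_fin am.
      apply: ge0_le_integral => //.
      - by move=> t _; rewrite lee_fin f0.
      - exact: mg.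
      - move=> t /=; rewrite in_itv/= => /andP[at_ tm]; rewrite lee_fin gE//.
        by apply: fr (ltW tm); exact: lt_trans at_.
    apply: ge0_subset_integral => //.
    - exact: mg.
    - by move=> t _; rewrite lee_fin f0.
    - by move=> t /=; rewrite !in_itv/= => /andP[-> tm]; exact: lt_trans mb.
  by rewrite -EFinM lee_fin leNgt mulr_gt0// subr_gt0.
exists m; rewrite mass; last 2 first.
- exact: measurable_itv.
- by rewrite /= in_itv/= andbT ltNge (ltW (lt_trans ca am)).
rewrite integral0_eq// => t /=; rewrite in_itv/= andbT => mt.
congr EFin; apply/eqP; rewrite eq_le f0 andbT -f_m; apply: fr (ltW mt).
exact: lt_trans am.
Qed.

(** A unimodal law would be carried by [-B, B]. Comparing its even moments with
    the contribution of a single jump that is at least 2 B then gives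
    d 4^k <= B^2 for all k, with d > 0 independent of k. *)
Theorem not_unimodal : ~ unimodal mu.
Proof.
move=> /unimodal_bounded[B0 hB0].
have [H H0 lawE] := law.
have hL := L2; pose B := 1 + L + `|B0|.
have B1 : 1 <= B by rewrite /B; have := normr_ge0 B0; lra.
have Bp : 0 < B by apply: lt_le_trans B1.
have ae : {ae mu, forall x : measurableTypeR R, `|x : R| <= B}.
  apply: (@negligibleS _ _ _ mu (`]-oo, (- L)[ `|` `]B0, +oo[)%classic).
    move=> t /= /negP; rewrite -ltNge ltr_normr !in_itv/= andbT => /orP[h|h].
      by right; have := ler_norm B0; rewrite /B in h; lra.
    by left; have := normr_ge0 B0; rewrite /B in h; lra.
  by apply: negligibleU; apply/negligibleP => //; exact: null_left.
have [i hi] : exists i, 2 * B <= jump i.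
  exists (Num.truncn (2 * B)).+1.
  by rewrite ltW// (lt_le_trans (truncnS_gt _))// jump_ge_nat.
pose d := s * weight i; have d0 : 0 < d by rewrite mulr_gt0 ?weight_gt0.
have key k : d * 4 ^+ k <= B ^+ 2.
  have [m [mE mB]] := law_even_moments s_gt0 H0 lawE k.
  have mle : m <= B ^+ (2 * k.+1).
    rewrite -lee_fin -mE.
    apply: (@le_trans _ _ (\int[mu]_x (B ^+ (2 * k.+1))%:E)%E).
      apply: ae_ge0_le_integral => //.
      + by move=> x _; rewrite lee_fin even_ge0.
      + by apply/measurable_EFinP; exact: exprn_measurable.
      + by move=> x _; rewrite lee_fin exprn_ge0// ltW.
      + apply: filterS ae => x xB _; rewrite lee_fin !exprM -(real_normK (num_real x)).
        by rewrite lerXn2r ?nnegrE ?sqr_ge0// lerXn2r ?nnegrE// ltW.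
    by rewrite integral_cst// -[leRHS]mule1 lee_pmul2l ?probability_le1// lte_fin exprn_gt0.
  have := le_trans (mB i) mle.
  rewrite mulrA -/d mulnS exprD [leRHS]mulrC => h.
  have B2k : 0 < B ^+ (2 * k) by rewrite exprn_gt0.
  rewrite -(ler_pM2l B2k); apply: le_trans h.
  rewrite mulrCA ler_pM2l// (_ : 4 = 2 ^+ 2); last by rewrite -natrX.
  by rewrite -exprM mulrC -exprMn lerXn2r ?nnegrE ?mulr_ge0// ltW// jump_gt0.
pose k := (Num.truncn (B ^+ 2 / d)).+1.
have := key k; rewrite mulrC -ler_pdivlMr// leNgt => /negP; apply.
rewrite (lt_le_trans (truncnS_gt _))// -/k -natrX ler_nat.
by rewrite ltnW// ltn_expl.
Qed.

(** |x|^n is at most 1 + x^(2n+2). *)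
Lemma all_moments n : mu.-integrable setT (fun x : R => (x ^+ n)%:E).
Proof.
have [H H0 lawE] := law.
have [m [mE _]] := law_even_moments s_gt0 H0 lawE n.
have i1 : mu.-integrable setT (EFin \o (fun x : R => x ^+ (2 * n.+1))).
  apply/integrableP; split; first by apply/measurable_EFinP; exact: exprn_measurable.
  apply: (@le_lt_trans _ _ (\int[mu]_x (x ^+ (2 * n.+1))%:E)%E); last by rewrite mE ltry.
  by rewrite le_eqVlt; apply/orP; left; apply/eqP; apply: eq_integral => x _; rewrite gee0_abs// lee_fin even_ge0.
have i2 : mu.-integrable setT (EFin \o (cst 1 : measurableTypeR R -> R)).
  by apply: (@bounded_integrable _ _ (cst 1) 1) => // x; rewrite normr1.
apply: le_integrable (integrableD measurableT i2 i1) => //.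
  by apply/measurable_EFinP; exact: exprn_measurable.
move=> x _; change (`|x ^+ n|%:E <= `|1 + x ^+ (2 * n.+1)|%:E)%E.
rewrite lee_fin [leRHS]ger0_norm; last by rewrite addr_ge0// even_ge0.
rewrite normrX; have [x1|x1] := leP `|x| 1.
  by rewrite (le_trans (exprn_ile1 n (normr_ge0 x) x1))// lerDl even_ge0.
rewrite (@le_trans _ _ (`|x| ^+ (2 * n.+1)))//.
  by rewrite ler_weXn2l ?(ltW x1)// mul2n -addnn addSn leqW// leq_addr.
by rewrite -normrX ger0_norm ?even_ge0// lerDr.
Qed.

End non_unimodality.

Local Close Scope complex_scope.

Theorem mainTheorem5 (R : realType) :
  exists mu : probability (measurableTypeR R) R,
    [/\ freely_infinitely_divisible mu,
        exists2 nu : {measure set (measurableTypeR R) -> \bar R},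
          free_levy_measure mu nu & ~ bounded_set (msupport nu),
        forall s : {nonneg R}, 0 < s%:num ->
          exists2 sigma : probability (measurableTypeR R) R,
            free_power mu s sigma & ~ unimodal sigma
      & forall n : nat, mu.-integrable setT (fun x : R => (x ^+ n)%:E)].
Proof.
have [mu [law1 gap1]] := law_with_gaps (@ltr01 R).
have t1 := law1_triplet law1.
exists mu; split.
- exact: law_fid.
- exists levy; last exact: levy_unbounded.
  by exists drift, 0.
- move=> s s0; have [sigma [laws gaps]] := law_with_gaps s0.
  exists sigma; last exact: (not_unimodal s0 laws gaps).
  by exists drift, 0, levy; split => //; exact: law_triplet.
- exact: (all_moments ltr01 law1).
Qed.
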